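(* Let $\kappa$ be a field and $\Gamma<\mathbb{R}$ a finitely generated subgroup. Suppose that $\Gamma$ is discrete and that there is a $t$-morphism from a filtered matched pair $\mathcal{P}$ to a filtered matched pair $\hat{\mathcal{P}}$, where $t\ge0$. Then there is a strong $t$-matching between the basis spectra $\Sigma(\mathcal{P})$ and $\Sigma(\hat{\mathcal{P}})$.
   Context: $\Lambda=\kappa[\Gamma]$ is the group algebra, written as finite sums $\sum_{g\in\Gamma}a_gT^g$, $a_g\in\kappa$. $\Lambda_{\uparrow}$ (resp. $\Lambda^{\downarrow}$) is the field of formal sums $\sum_{g\in\Gamma}a_gT^g$ such that for every $C\in\mathbb{R}$ only finitely many $g$ with $g<C$ (resp. $g>-C$) have $a_g\ne0$. $\nu_{\uparrow}(\sum a_gT^g)=\min\{g: a_g\neq 0\}$ on $\Lambda_{\uparrow}$ ($\nu_\uparrow(0)=+\infty$), $\nu^{\downarrow}(\sum a_gT^g)=\max\{g:a_g\ne0\}$ on $\Lambda^{\downarrow}$ ($\nu^{\downarrow}(0)=-\infty$). A normed $\Lambda_{\uparrow}$-space $(V_{\uparrow},\rho_{\uparrow})$ is a finite-dimensional $\Lambda_{\uparrow}$-vector space with $\rho_{\uparrow}:V_{\uparrow}\to\mathbb{R}\cup\{-\infty\}$ such that $\rho_{\uparrow}(x)=-\infty$ iff $x=0$; $\rho_{\uparrow}(\lambda x)=\rho_{\uparrow}(x)-\nu_{\uparrow}(\lambda)$; $\rho_{\uparrow}(x+y)\le\max\{\rho_{\uparrow}(x),\rho_{\uparrow}(y)\}$.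 A normed $\Lambda^{\downarrow}$-space $(V^{\downarrow},\rho^{\downarrow})$ is a finite-dimensional $\Lambda^{\downarrow}$-vector space with $\rho^{\downarrow}:V^{\downarrow}\to\mathbb{R}\cup\{\infty\}$ such that $\rho^{\downarrow}(x)=\infty$ iff $x=0$; $\rho^{\downarrow}(\lambda x)=\rho^{\downarrow}(x)-\nu^{\downarrow}(\lambda)$; $\rho^{\downarrow}(x+y)\ge\min\{\rho^{\downarrow}(x),\rho^{\downarrow}(y)\}$. A subset $\{x_1,\dots,x_k\}$ is $\rho_{\uparrow}$-orthogonal if $\rho_{\uparrow}(\sum\lambda_ix_i)=\max_i(\rho_{\uparrow}(x_i)-\nu_{\uparrow}(\lambda_i))$ for all $\lambda_i\in\Lambda_{\uparrow}$, and $\rho^{\downarrow}$-orthogonal if $\rho^{\downarrow}(\sum\lambda_ix_i)=\min_i(\rho^{\downarrow}(x_i)-\nu^{\downarrow}(\lambda_i))$ for all $\lambda_i\in\Lambda^{\downarrow}$. A filtered matched pair consists of a finitely generated $\Lambda$-module $H$, a normed $\Lambda_{\uparrow}$-space $(V_{\uparrow},\rho_{\uparrow})$, a normed $\Lambda^{\downarrow}$-space $(V^{\downarrow},\rho^{\downarrow})$, and $\Lambda$-module homomorphisms $\phi_{\uparrow}:H\to V_{\uparrow}$, $\phi^{\downarrow}:H\to V^{\downarrow}$ such that $1\otimes\phi_{\uparrow}:\Lambda_{\uparrow}\otimes_{\Lambda}H\to V_{\uparrow}$ and $1\otimes\phi^{\downarrow}:\Lambda^{\downarrow}\otimes_{\Lambda}H\to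 V^{\downarrow}$ are isomorphisms. A doubly-orthogonal basis is a subset $\{e_1,\dots,e_d\}\subset H$ projecting to a basis of the $\Lambda$-module $H/tH$ ($tH$ the $\Lambda$-torsion submodule) with $\{\phi_{\uparrow}e_i\}$ a $\rho_{\uparrow}$-orthogonal basis of $V_{\uparrow}$ and $\{\phi^{\downarrow}e_i\}$ a $\rho^{\downarrow}$-orthogonal basis of $V^{\downarrow}$; one always exists when $\Gamma$ is discrete. The basis spectrum $\Sigma(\mathcal{P})$ is the multiset of pairs $([\rho_{\uparrow}(\phi_{\uparrow}e_i)],\ \rho^{\downarrow}(\phi^{\downarrow}e_i)-\rho_{\uparrow}(\phi_{\uparrow}e_i))\in(\mathbb{R}/\Gamma)\times\mathbb{R}$; it is independent of the doubly-orthogonal basis. Let $\mathcal{P}$ be given by $\phi_{\uparrow}:H\to(V_{\uparrow},\rho_{\uparrow})$, $\phi^{\downarrow}:H\to(V^{\downarrow},\rho^{\downarrow})$ and $\hat{\mathcal{P}}$ by $\psi_{\uparrow}:H\to(\hat V_{\uparrow},\hat\rho_{\uparrow})$, $\psi^{\downarrow}:H\to(\hat V^{\downarrow},\hat\rho^{\downarrow})$, with the same $\Lambda$-module $H$. For $t\geq 0$, a $t$-morphism from $\mathcal{P}$ to $\hat{\mathcal{P}}$ consists of a $\Lambda_{\uparrow}$-linear isomorphism $\alpha_{\uparrow}:V_{\uparrow}\to\hat V_{\uparrow}$ and a $\Lambda^{\downarrow}$-linear isomorphism $\alpha^{\downarrow}:V^{\downarrow}\to\hat V^{\downarrow}$ with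 $\psi_{\uparrow}=\alpha_{\uparrow}\circ\phi_{\uparrow}$, $\psi^{\downarrow}=\alpha^{\downarrow}\circ\phi^{\downarrow}$, and $|\rho_{\uparrow}(\phi_{\uparrow}(x))-\hat\rho_{\uparrow}(\psi_{\uparrow}(x))|\le t$ and $|\rho^{\downarrow}(\phi^{\downarrow}(x))-\hat\rho^{\downarrow}(\psi^{\downarrow}(x))|\le t$ for all $x\in H\setminus tH$. A strong $t$-matching between multisets $\mathcal{S},\hat{\mathcal{S}}$ of elements of $(\mathbb{R}/\Gamma)\times\mathbb{R}$ is a bijection $\sigma:\mathcal{S}\to\hat{\mathcal{S}}$ such that whenever $\sigma([a],\ell)=([\hat a],\hat\ell)$ there is $g\in\Gamma$ with $|g+\hat a-a|\le t$ and $|(g+\hat a+\hat\ell)-(a+\ell)|\le t$. *)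

(* Defs.v *)
From HB Require Import structures.
From mathcomp Require Import all_boot all_order all_algebra.
From mathcomp Require Import generic_quotient ring_quotient.
From mathcomp Require Import finmap multiset.
From mathcomp Require Import all_classical all_reals.
From mathcomp Require Import ereal topology normedtype.
From mathcomp Require Import lra.

Set Implicit Arguments.
Unset Strict Implicit.
Unset Printing Implicit Defensive.

Import Order.TTheory GRing.Theory Num.Theory.
Import numFieldNormedType.Exports.

Local Open Scope classical_set_scope.
Local Open Scope ring_scope.

(** The group algebra and its two completions share one construction: formal
    sums over [Gamma] whose supports range over a class of subsets of [R]. *)

Variant support_kind := FinSupp | UpSupp | DownSupp.

Definition admissible (R : realType) (k : support_kind) (A : set R) : Prop :=
  match k with
  | FinSupp => finite_set A
  | UpSupp => forall C : R, finite_set (A `&` [set g | g < C])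
  | DownSupp => forall C : R, finite_set (A `&` [set g | g > - C])
  end.

Section Admissible.
Context (R : realType).
Implicit Types (A B : set R) (k : support_kind).

Lemma admissible_opp A :
  admissible DownSupp A <-> admissible UpSupp [set x | A (- x)].
Proof.
split=> adA C; have := finite_image -%R (adA C); apply: sub_finite_set.
- by move=> x [/= Ax xC]; exists (- x); rewrite /= ?opprK// ltrN2.
- by move=> x [/= Ax xC]; exists (- x); rewrite /= ?opprK// ltrNl.
Qed.

Lemma admissible_sub k A B : A `<=` B -> admissible k B -> admissible k A.
Proof.
move=> AB; case: k => /= [|adB C|adB C]; first exact: sub_finite_set.
- by apply: sub_finite_set (adB C); exact: setSI.
- by apply: sub_finite_set (adB C); exact: setSI.
Qed.

Lemma finite_admissible k A : finite_set A -> admissible k A.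
Proof.
by case: k => [//|fA C|fA C]; exact: finite_setIl.
Qed.

Lemma admissibleU k A B :
  admissible k A -> admissible k B -> admissible k (A `|` B).
Proof.
case: k => /= [fA fB|fA fB C|fA fB C]; rewrite ?setIUl finite_setU//.
Qed.

Lemma finite_min A x : finite_set A -> A x ->
  exists2 m, A m & forall y, A y -> m <= y.
Proof.
move=> /finite_seqP[s ->]; elim: s x => [//|z [|t s] IHs] x _ /=.
  by exists z; rewrite ?inE// => y /[1!inE] /eqP->.
have [m ms mP] := IHs t (mem_head _ _).
exists (Num.min z m) => [|y /[1!inE] /orP[/eqP->|/mP mt]].
- by rewrite /Num.min; case: ifP => _; rewrite inE ?eqxx// ms orbT.
- by rewrite ge_min lexx.
- by rewrite ge_min mt orbT.
Qed.

Lemma finite_lb A : finite_set A -> exists m : R, forall x, A x -> m <= x.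
Proof.
have [->|/set0P[x Ax] fA] := eqVneq A set0; first by exists 0.
by have [m _ mP] := finite_min fA Ax; exists m.
Qed.

Lemma admissible_lb A :
  admissible UpSupp A -> exists m : R, forall x, A x -> m <= x.
Proof.
move=> /(_ 0) /finite_lb[m mP]; exists (Num.min m 0) => x Ax; rewrite ge_min.
by have [x0|x0] := leP 0 x; rewrite ?orbT// mP.
Qed.

Lemma admissible_min A x : admissible UpSupp A -> A x ->
  exists2 m, A m & forall y, A y -> m <= y.
Proof.
move=> adA Ax; have := adA (x + 1).
move=> /finite_min/(_ (conj Ax _))[/=|m [/= Am mx] mP]; first by lra.
exists m => // y Ay; have [?|?] := ltP y (x + 1); first exact: mP.
by lra.
Qed.

Lemma admissible_sum k A B : admissible k A -> admissible k B ->
  admissible k [set x + y | x in A & y in B].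
Proof.
have up A' B' : admissible UpSupp A' -> admissible UpSupp B' ->
    admissible UpSupp [set x + y | x in A' & y in B'].
  move=> adA adB C; have [m mP] := admissible_lb adA.
  have [n nP] := admissible_lb adB.
  have := finite_image2 +%R (adA (C - n)) (adB (C - m)).
  apply: sub_finite_set => z [/= [x Ax [y By <-]] xyC].
  have mx := mP _ Ax; have ny := nP _ By.
  by exists x; [split=> //=; lra|exists y => //; split=> //=; lra].
case: k => [fA fB|adA adB|]; [exact: finite_image2|exact: up|].
move=> /admissible_opp adA /admissible_opp adB; apply/admissible_opp.
apply: admissible_sub (up _ _ adA adB) => z /= [x Ax [y By xyz]].
exists (- x); rewrite /= ?opprK//; exists (- y); rewrite /= ?opprK//.
by rewrite -opprD xyz opprK.
Qed.

Lemma admissible_pair k A B g : admissible k A -> admissible k B ->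
  finite_set [set h | A h /\ B (g - h)].
Proof.
have up A' B' g' : admissible UpSupp A' -> admissible UpSupp B' ->
    finite_set [set h | A' h /\ B' (g' - h)].
  move=> adA /admissible_lb[n nP]; apply: sub_finite_set (adA (g' - n + 1)).
  by move=> h [Ah /nP ?]; split=> //=; lra.
case: k => [fA _|adA adB|]; [|exact: up|].
  by apply: sub_finite_set fA => h [].
move=> /admissible_opp adA /admissible_opp adB.
have := finite_image -%R (up _ _ (- g) adA adB); apply: sub_finite_set => h.
move=> [Ah Bh]; exists (- h); rewrite /= ?opprK//; split=> //.
by rewrite opprD !opprK.
Qed.
End Admissible.

Section FormalSums.
Context (R : realType) (Gamma : zmodClosed R) (K : fieldType).
Context (k : support_kind).

Definition supp (a : R -> K) : set R := [set g | a g != 0].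

Definition is_formal_sum : {pred R -> K} :=
  fun a => `[< (forall g, supp a g -> g \in Gamma) /\ admissible k (supp a) >].

(** [\sum_g (a g) T^g]. *)
Record formal_sum := FormalSum { coef :> R -> K; _ : is_formal_sum coef }.

HB.instance Definition _ := [isSub for coef].
HB.instance Definition _ := [Choice of formal_sum by <:].

Lemma is_formal_sum_zmod_closed : zmod_closed is_formal_sum.
Proof.
split.
  apply/asboolP; split=> [g|]; first by rewrite /supp /= eqxx.
  suff -> : supp 0 = set0 by exact: finite_admissible.
  by apply/seteqP; split=> g //=; rewrite /supp /= eqxx.
move=> a b /asboolP[aG ada] /asboolP[bG adb]; apply/asboolP.
have sub : supp (a - b) `<=` supp a `|` supp b.
  move=> g; rewrite /supp /= -[(a - b) g]/(a g - b g).
  have [->|?] := eqVneq (a g) 0; last by left.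
  by rewrite sub0r oppr_eq0; right.
split=> [g /sub[/aG|/bG]//|].
by apply: admissible_sub sub _; exact: admissibleU.
Qed.
HB.instance Definition _ :=
  GRing.isZmodClosed.Build (R -> K) is_formal_sum is_formal_sum_zmod_closed.
HB.instance Definition _ := [SubChoice_isSubZmodule of formal_sum by <:].

Implicit Types (a b c : formal_sum).

Lemma formal_sumP a b : (forall g, a g = b g) -> a = b.
Proof. by move=> ab; apply/val_inj/funext. Qed.

Lemma fsD a b g : (a + b) g = a g + b g. Proof. by []. Qed.
Lemma fsN a g : (- a) g = - a g. Proof. by []. Qed.
Lemma fs0 g : (0 : formal_sum) g = 0. Proof. by []. Qed.
Lemma fs_sum I (r : seq I) (P : pred I) (F : I -> formal_sum) g :
  (\sum_(i <- r | P i) F i) g = \sum_(i <- r | P i) F i g.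
Proof. by elim/big_rec2: _ => // i x y _ <-. Qed.

Lemma supp_Gamma a g : a g != 0 -> g \in Gamma.
Proof. by case: a => a /= /asboolP[+ _]; exact. Qed.

Lemma supp_admissible a : admissible k (supp a).
Proof. by case: a => a /= /asboolP[]. Qed.

Lemma finite_supp_mul a b g : finite_set [set h | a h != 0 /\ b (g - h) != 0].
Proof. exact: admissible_pair (supp_admissible a) (supp_admissible b). Qed.

(** The coefficient of [T^g] in a product; by [finite_supp_mul] only finitely
    many terms are nonzero. *)
Definition mul_coef (a b : R -> K) (g : R) : K :=
  \sum_(h \in [set: R]) a h * b (g - h).

Lemma mul_coefE (a b : R -> K) g (s : {fset R}) :
  (forall h, a h != 0 -> b (g - h) != 0 -> h \in s) ->
  mul_coef a b g = \sum_(h <- s) a h * b (g - h).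
Proof.
move=> sP; apply: fsbigTE => h /negP hs; apply/eqP; rewrite mulf_eq0.
by apply: contraT; rewrite negb_or => /andP[? ?]; case: hs; exact: sP.
Qed.

Lemma mul_coef_neq0 (a b : R -> K) g :
  mul_coef a b g != 0 -> exists h, a h != 0 /\ b (g - h) != 0.
Proof.
apply: contra_neqP => /forallNP ab; apply: fsbig1 => h _.
apply/eqP; rewrite mulf_eq0; apply: contraT; rewrite negb_or => /andP[? ?].
by case: (ab h).
Qed.

Lemma mul_is_formal_sum a b : is_formal_sum (mul_coef a b).
Proof.
apply/asboolP; split=> [g /mul_coef_neq0[h [ah bgh]]|].
  by rewrite -(subrK h g) rpredD// (supp_Gamma ah, supp_Gamma bgh).
apply: admissible_sub (admissible_sum (supp_admissible a) (supp_admissible b)).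
move=> g /mul_coef_neq0[h [ah bgh]]; exists h => //; exists (g - h) => //.
by rewrite addrC subrK.
Qed.

Definition fs_mul a b := FormalSum (mul_is_formal_sum a b).

Lemma monomial_is_formal_sum (g : R) (x : K) : g \in Gamma ->
  is_formal_sum (fun h => x *+ (h == g)).
Proof.
have sub : supp (fun h => x *+ (h == g)) `<=` [set g].
  by move=> h; rewrite /supp /=; case: (h =P g) => //; rewrite eqxx.
move=> gG; apply/asboolP; split=> [h /sub -> //|].
by apply/finite_admissible/(sub_finite_set sub)/finite_set1.
Qed.

(** [x T^g] *)
Definition monomial g (gG : g \in Gamma) (x : K) :=
  FormalSum (monomial_is_formal_sum x gG).
Definition fs_one := monomial (rpred0 Gamma) 1.

Lemma fs_mulC : commutative fs_mul.
Proof.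
move=> a b; apply: formal_sumP => g; rewrite /= /mul_coef.
rewrite (reindex_fsbigT (fun h => g - h)); last first.
  by exists (fun h => g - h) => h; rewrite subKr.
by apply: eq_fsbigr => h _; rewrite subKr mulrC.
Qed.

Lemma fs_mulA : associative fs_mul.
Proof.
move=> a b c; apply: formal_sumP => g /=.
have [ada adb adc] := And3 (supp_admissible a) (supp_admissible b)
  (supp_admissible c).
have /finite_fsetP[S SE] := admissible_pair g ada (admissible_sum adb adc).
have /finite_fsetP[M ME] := admissible_pair g (admissible_sum ada adb) adc.
have SP h l : a h != 0 -> b l != 0 -> c (g - h - l) != 0 -> h \in S.
  move=> ah bl cghl; suff : [set` S] h by [].
  rewrite -SE; split=> //; exists l => //; exists (g - h - l) => //.
  by rewrite addrC subrK.
have MP h m : a h != 0 -> b (m - h) != 0 -> c (g - m) != 0 -> m \in M.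
  move=> ah bmh cgm; suff : [set` M] m by [].
  rewrite -ME; split=> //; exists h => //; exists (m - h) => //.
  by rewrite addrC subrK.
rewrite (@mul_coefE _ _ _ S); last first.
  move=> h ah /mul_coef_neq0[l [bl cl]]; exact: SP ah bl cl.
rewrite (@mul_coefE _ _ _ M); last first.
  by move=> m /mul_coef_neq0[h [ah bh]]; exact: MP ah bh.
under [RHS]eq_bigr => m _.
  have -> : mul_coef a b m * c (g - m) =
      \sum_(h <- S) a h * (b (m - h) * c (g - m)).
    have [->|cgm] := eqVneq (c (g - m)) 0.
      by rewrite mulr0 big1// => h _; rewrite !mulr0.
    rewrite (@mul_coefE _ _ _ S) ?mulr_suml; last first.
      by move=> h ah bmh; apply: SP ah bmh _; rewrite opprB addrA subrK.
    by apply: eq_bigr => h _; rewrite mulrA.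
  over.
rewrite exchange_big/=; apply: eq_bigr => h _; rewrite -mulr_sumr.
have [->|ah] := eqVneq (a h) 0; first by rewrite !mul0r.
congr (_ * _); rewrite -fsbigTE => [|m mM]; last first.
  apply/eqP; rewrite mulf_eq0; apply: contraNT mM; rewrite negb_or.
  by move=> /andP[bmh cgm]; exact: MP ah bmh cgm.
rewrite [RHS](reindex_fsbigT (fun l => l + h)); last first.
  by exists (fun l => l - h) => l; rewrite (addrK, subrK).
by apply: eq_fsbigr => l _; rewrite addrK opprD addrA addrAC.
Qed.

Lemma fs_mul1 : left_id fs_one fs_mul.
Proof.
move=> a; apply: formal_sumP => g /=.
rewrite (@mul_coefE _ _ _ [fset 0]%fset) ?big_seq_fset1 ?eqxx ?subr0 ?mul1r//.
by move=> h; rewrite inE; case: (h =P 0) => //; rewrite mulr0n eqxx.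
Qed.

Lemma fs_mulDl : left_distributive fs_mul +%R.
Proof.
move=> a b c; apply: formal_sumP => g; rewrite fsD /=.
have fa := finite_supp_mul a c g; have fb := finite_supp_mul b c g.
pose s := (fset_set [set h | a h != 0 /\ c (g - h) != 0] `|`
  fset_set [set h | b h != 0 /\ c (g - h) != 0])%fset.
have sa h : a h != 0 -> c (g - h) != 0 -> h \in s.
  by move=> ? ?; rewrite in_fsetU !in_fset_set// (_ : h \in _)// inE.
have sb h : b h != 0 -> c (g - h) != 0 -> h \in s.
  by move=> ? ?; rewrite in_fsetU !in_fset_set// orbC (_ : h \in _)// inE.
have sab h : (a + b) h != 0 -> c (g - h) != 0 -> h \in s.
  rewrite fsD; have [->|ah _] := eqVneq (a h) 0; last exact: sa.
  by rewrite add0r; exact: sb.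
rewrite (mul_coefE sa) (mul_coefE sb) (mul_coefE sab) -big_split/=.
by apply: eq_bigr => h _; rewrite -mulrDl.
Qed.

Lemma fs_one_neq0 : fs_one != 0.
Proof.
apply/eqP => /(congr1 (fun a : formal_sum => a 0)).
by rewrite fs0 /= eqxx; apply/eqP/oner_neq0.
Qed.

HB.instance Definition _ :=
  GRing.Zmodule_isComNzRing.Build formal_sum fs_mulA fs_mulC fs_mul1 fs_mulDl fs_one_neq0.

Lemma fsM a b g : (a * b) g = \sum_(h \in [set: R]) a h * b (g - h).
Proof. by []. Qed.

Lemma fs1 g : (1 : formal_sum) g = (g == 0)%:R. Proof. by []. Qed.

Lemma fs_monomialM g (gG : g \in Gamma) x a h :
  (monomial gG x * a) h = x * a (h - g).
Proof.
rewrite [LHS](@mul_coefE _ _ _ [fset g]%fset) ?big_seq_fset1 /= ?eqxx//.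
by move=> l; rewrite inE; case: (l =P g) => //; rewrite mulr0n eqxx.
Qed.

Lemma fsM_neq0 a b g :
  (a * b) g != 0 -> exists h, a h != 0 /\ b (g - h) != 0.
Proof. exact: mul_coef_neq0. Qed.

Lemma fs_neq0 a : a != 0 -> exists g, a g != 0.
Proof.
apply: contra_neqP => /forallNP a0; apply: formal_sumP => g.
by rewrite fs0; apply/eqP; apply: contraT => /(a0 g).
Qed.

End FormalSums.
Arguments monomial {R Gamma K k g} gG x.

Section Inverse.
Context (R : realType) (Gamma : zmodClosed R) (K : fieldType).
Local Notation up := (formal_sum Gamma K UpSupp).
Local Notation down := (formal_sum Gamma K DownSupp).

Lemma up_supp_min (a : up) :
  a != 0 -> exists2 m, a m != 0 & forall g, a g != 0 -> m <= g.
Proof.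
by move=> /fs_neq0[g0 ag0]; exact: admissible_min (supp_admissible a) ag0.
Qed.

Lemma down_supp_max (a : down) :
  a != 0 -> exists2 m, a m != 0 & forall g, a g != 0 -> g <= m.
Proof.
move=> /fs_neq0[g0 ag0]; have /admissible_opp/admissible_min := supp_admissible a.
move=> /(_ (- g0))[|m am mP]; first by rewrite /supp /= opprK.
exists (- m) => // g ag; rewrite lerNr; apply: mP.
by rewrite /supp /= opprK.
Qed.

Section Geometric.
Context (u : up) (eps : R) (eps_gt0 : 0 < eps).
Hypothesis u_ge : forall g, u g != 0 -> eps <= g.

Let expu_ge n g : (u ^+ n) g != 0 -> eps *+ n <= g.
Proof.
elim: n g => [|n IHn] g.
  by rewrite expr0 fs1; case: (g =P 0) => [->|]//; rewrite eqxx.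
rewrite exprS => /fsM_neq0[h [/u_ge uh /IHn]]; rewrite mulrS; lra.
Qed.

Let psum n : up := \sum_(0 <= i < n) u ^+ i.
Let rank g := (Num.truncn (g / eps)).+1.

Let rankP g : g < eps *+ rank g.
Proof. by rewrite -mulr_natr mulrC -ltr_pdivrMr// truncnS_gt. Qed.

Let psum_stable n m g : g < eps *+ n -> g < eps *+ m -> psum n g = psum m g.
Proof.
wlog le_nm : n m / (n <= m)%N => [th gn gm|gn _].
  by case/orP: (leq_total n m) => ?; [exact: th|apply/esym; exact: th].
rewrite /psum (big_cat_nat (leq0n n) le_nm) fsD [X in _ + X]fs_sum.
rewrite [X in _ + X]big_nat [X in _ + X]big1 ?addr0// => i /andP[ni _].
apply/eqP; apply: contraLR gn => /expu_ge ig.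
by rewrite -leNgt (le_trans _ ig)// ler_wpMn2l// ltW.
Qed.

Let geo g := psum (rank g) g.

Let geo_is_formal_sum : is_formal_sum Gamma UpSupp geo.
Proof.
apply/asboolP; split=> [g|C]; first exact: supp_Gamma.
apply: sub_finite_set (supp_admissible (psum (rank C)) C) => g [/= geog gC].
split=> //; move: geog; rewrite /supp /= /geo.
by rewrite (@psum_stable _ (rank C))//; exact: lt_trans gC _.
Qed.

Let geo_up : up := FormalSum geo_is_formal_sum.

Let geo_inv : (1 - u) * geo_up = 1.
Proof.
apply: formal_sumP => g; set n := rank g.
have -> : ((1 - u) * geo_up) g = ((1 - u) * psum n) g.
  rewrite !fsM; apply: eq_fsbigr => h _.
  have [->|uh] := eqVneq ((1 - u) h) 0; first by rewrite !mul0r.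
  congr (_ * _); apply: psum_stable => //; have := rankP g.
  suff : 0 <= h by rewrite -/n; lra.
  move: uh; rewrite fsD fsN fs1; have [->//|_] := eqVneq h 0.
  by rewrite sub0r oppr_eq0 => /u_ge; apply: le_trans; exact: ltW.
rewrite -opprB mulNr /psum big_mkord -subrX1 opprB fsD fsN.
have [->|/expu_ge] := eqVneq ((u ^+ n) g) 0; first by rewrite subr0.
by rewrite leNgt rankP.
Qed.

Lemma geometric_inverse : exists b, (1 - u) * b = 1.
Proof. by exists geo_up. Qed.
End Geometric.

Lemma up_inverse (a : up) : a != 0 -> exists b, a * b = 1.
Proof.
move=> /up_supp_min[m am mP].
have mG : - m \in Gamma by rewrite rpredN (supp_Gamma am).
pose c : up := monomial mG (a m)^-1; pose u := 1 - c * a.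
have uE g : u g = (g == 0)%:R - (a m)^-1 * a (g + m).
  by rewrite /u fsD fsN fs1 fs_monomialM opprK.
have u_gt0 g : u g != 0 -> 0 < g.
  rewrite uE; have [->|g0] := eqVneq g 0; first by rewrite add0r mulVf// subrr eqxx.
  rewrite sub0r oppr_eq0 mulf_eq0 negb_or => /andP[_ /mP].
  by rewrite lerDr le_eqVlt eq_sym (negPf g0).
have [eps eps0 epsP] : exists2 eps : R, 0 < eps & forall g, u g != 0 -> eps <= g.
  have [u0|/up_supp_min[e ue eP]] := eqVneq u 0; last by exists e => //; exact: u_gt0.
  by exists 1 => // g; rewrite u0 fs0 eqxx.
have [b] := geometric_inverse eps0 epsP.
by rewrite /u subKr => cab; exists (c * b); rewrite mulrCA mulrA.
Qed.

Lemma flip_is_formal_sum k k' (a : formal_sum Gamma K k) :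
  admissible k' [set g | a (- g) != 0] -> is_formal_sum Gamma k' (a \o -%R).
Proof.
move=> ada; apply/asboolP; split=> // g /supp_Gamma.
by rewrite rpredN.
Qed.

Lemma down_inverse (a : down) : a != 0 -> exists b, a * b = 1.
Proof.
move=> a0; have /flip_is_formal_sum fa : admissible UpSupp [set g | a (- g) != 0].
  by have /admissible_opp := supp_admissible a.
pose a' : up := FormalSum fa.
have /up_inverse[b' ab'] : a' != 0.
  have [g ag] := fs_neq0 a0; apply/eqP => /(congr1 (fun c : up => c (- g))).
  by rewrite fs0 /= opprK => /eqP; apply/negP.
have /flip_is_formal_sum fb : admissible DownSupp [set g | b' (- g) != 0].
  apply/admissible_opp; apply: admissible_sub (supp_admissible b') => g /=.
  by rewrite opprK.
exists (FormalSum fb); apply: formal_sumP => g.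
rewrite fsM (reindex_fsbigT -%R); last by exists -%R => h; rewrite opprK.
transitivity ((a' * b') (- g)); last by rewrite ab' !fs1 oppr_eq0.
by rewrite fsM; apply: eq_fsbigr => h _ /=; rewrite opprD opprK.
Qed.
End Inverse.

Section Rings.
Context (R : realType) (Gamma : zmodClosed R) (K : fieldType).

Definition Lambda := formal_sum Gamma K FinSupp.
HB.instance Definition _ := GRing.ComNzRing.on Lambda.

Definition Lambda_up := formal_sum Gamma K UpSupp.
HB.instance Definition _ := GRing.ComNzRing.on Lambda_up.

Definition Lambda_down := formal_sum Gamma K DownSupp.
HB.instance Definition _ := GRing.ComNzRing.on Lambda_down.

Definition inv_up (a : Lambda_up) : Lambda_up := xget 0 [set b | a * b = 1].

Lemma mulVf_up (a : Lambda_up) : a != 0 -> inv_up a * a = 1.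
Proof. by move=> /up_inverse /(xgetPex 0); rewrite mulrC. Qed.

Lemma inv_up0 : inv_up 0 = 0.
Proof.
by apply: xgetPN => b /esym/eqP; rewrite mul0r oner_eq0.
Qed.

HB.instance Definition _ :=
  GRing.ComNzRing_isField.Build Lambda_up mulVf_up inv_up0.

Definition inv_down (a : Lambda_down) : Lambda_down :=
  xget 0 [set b | a * b = 1].

Lemma mulVf_down (a : Lambda_down) : a != 0 -> inv_down a * a = 1.
Proof. by move=> /down_inverse /(xgetPex 0); rewrite mulrC. Qed.

Lemma inv_down0 : inv_down 0 = 0.
Proof.
by apply: xgetPN => b /esym/eqP; rewrite mul0r oner_eq0.
Qed.

HB.instance Definition _ :=
  GRing.ComNzRing_isField.Build Lambda_down mulVf_down inv_down0.

Lemma incl_is_formal_sum k (a : Lambda) : is_formal_sum Gamma k a.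
Proof.
apply/asboolP; split=> [g|]; first exact: supp_Gamma.
exact/finite_admissible/(supp_admissible a).
Qed.

(** The inclusions of the group algebra into its completions. *)
Definition to_up (a : Lambda) : Lambda_up :=
  FormalSum (incl_is_formal_sum UpSupp a).
Definition to_down (a : Lambda) : Lambda_down :=
  FormalSum (incl_is_formal_sum DownSupp a).

Lemma to_up_is_zmod_morphism : zmod_morphism to_up.
Proof. by move=> a b; apply: formal_sumP. Qed.
Lemma to_up_is_monoid_morphism : monoid_morphism to_up.
Proof. by split=> [|a b]; apply: formal_sumP. Qed.
HB.instance Definition _ :=
  GRing.isZmodMorphism.Build Lambda Lambda_up to_up to_up_is_zmod_morphism.
HB.instance Definition _ :=
  GRing.isMonoidMorphism.Build Lambda Lambda_up to_up to_up_is_monoid_morphism.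

Lemma to_down_is_zmod_morphism : zmod_morphism to_down.
Proof. by move=> a b; apply: formal_sumP. Qed.
Lemma to_down_is_monoid_morphism : monoid_morphism to_down.
Proof. by split=> [|a b]; apply: formal_sumP. Qed.
HB.instance Definition _ := GRing.isZmodMorphism.Build
  Lambda Lambda_down to_down to_down_is_zmod_morphism.
HB.instance Definition _ := GRing.isMonoidMorphism.Build
  Lambda Lambda_down to_down to_down_is_monoid_morphism.

Lemma Lambda_mul_neq0 (a b : Lambda) : a != 0 -> b != 0 -> a * b != 0.
Proof.
have up0 (c : Lambda) : (to_up c == 0) = (c == 0).
  apply/eqP/eqP => [/(congr1 (@coef _ _ _ _)) c0|->]; last exact: raddf0.
  by apply: formal_sumP => g; exact: (congr1 (fun f => f g) c0).
by rewrite -!up0 rmorphM => a0 b0; exact: mulf_neq0.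
Qed.

Definition nu_up (a : Lambda_up) : \bar R := ereal_inf [set g%:E | g in supp a].
Definition nu_down (a : Lambda_down) : \bar R :=
  ereal_sup [set g%:E | g in supp a].

(** The infimum and the supremum are attained. *)
Lemma nu_up_min (a : Lambda_up) : a != 0 ->
  exists2 m, a m != 0 & nu_up a = m%:E.
Proof.
move=> /up_supp_min[m am mP]; exists m => //; apply/le_anti/andP; split.
  by apply: ereal_inf_lbound; exists m.
by apply: le_ereal_inf_tmp => _ [g ag <-]; rewrite lee_fin mP.
Qed.

Lemma nu_down_max (a : Lambda_down) : a != 0 ->
  exists2 m, a m != 0 & nu_down a = m%:E.
Proof.
move=> /down_supp_max[m am mP]; exists m => //; apply/le_anti/andP; split.
  by apply: ge_ereal_sup => _ [g ag <-]; rewrite lee_fin mP.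
by apply: ereal_sup_ubound; exists m.
Qed.

Lemma nu_up0 : nu_up 0 = +oo%E.
Proof.
rewrite /nu_up (_ : supp 0 = set0) ?image_set0 ?ereal_inf0//.
by apply/seteqP; split=> g //=; rewrite /supp /= eqxx.
Qed.

Lemma nu_down0 : nu_down 0 = -oo%E.
Proof.
rewrite /nu_down (_ : supp 0 = set0) ?image_set0 ?ereal_sup0//.
by apply/seteqP; split=> g //=; rewrite /supp /= eqxx.
Qed.

End Rings.

Section Tensor.
Context (A B : comNzRingType) (f : {rmorphism A -> B}) (H : lmodType A).

(** A list [[:: (b1, h1); ...; (bn, hn)]] stands for the element
    [b1 (x) h1 + ... + bn (x) hn] of the tensor product of [B] and [H] over
    [A]; [tensor_eq] is the congruence generated by bilinearity and balance. *)
Inductive tensor_eq : seq (B * H) -> seq (B * H) -> Prop :=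
| tensor_refl s : tensor_eq s s
| tensor_sym s t : tensor_eq s t -> tensor_eq t s
| tensor_trans s t u : tensor_eq s t -> tensor_eq t u -> tensor_eq s u
| tensor_cat s s' t t' :
    tensor_eq s s' -> tensor_eq t t' -> tensor_eq (s ++ t) (s' ++ t')
| tensor_catC s t : tensor_eq (s ++ t) (t ++ s)
| tensor_0l h : tensor_eq [:: (0, h)] [::]
| tensor_Dl b b' h : tensor_eq [:: (b + b', h)] [:: (b, h); (b', h)]
| tensor_Dr b h h' : tensor_eq [:: (b, h + h')] [:: (b, h); (b, h')]
| tensor_bal b a h : tensor_eq [:: (b * f a, h)] [:: (b, a *: h)].

Definition tensor_eqb (s t : seq (B * H)) : bool := `[< tensor_eq s t >].

Lemma tensor_eqb_is_equiv : equiv_class_of tensor_eqb.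
Proof.
split=> [s|s t|t s u]; first by apply/asboolP; exact: tensor_refl.
  by apply/asboolP/asboolP; exact: tensor_sym.
by move=> /asboolP st /asboolP tu; apply/asboolP; exact: tensor_trans st tu.
Qed.
Canonical tensor_equiv := EquivRelPack tensor_eqb_is_equiv.
Canonical tensor_encModRel := defaultEncModRel tensor_eqb.

Definition tensor := {eq_quot tensor_eqb}%qT.
HB.instance Definition _ : EqQuotient _ tensor_eqb tensor :=
  EqQuotient.on tensor.
HB.instance Definition _ := Choice.on tensor.

Definition tens (s : seq (B * H)) : tensor := \pi_tensor%qT s.
Definition pure (b : B) (h : H) : tensor := tens [:: (b, h)].

Lemma tensP s t : tens s = tens t <-> tensor_eq s t.
Proof.
split=> [/eqP|st]; first by rewrite /tens piE => /asboolP.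
by apply/eqP; rewrite /tens piE; apply/asboolP.
Qed.

Lemma tens_repr (x : tensor) : tens (repr x) = x.
Proof. exact: reprK. Qed.

Lemma repr_tens s : tensor_eq (repr (tens s)) s.
Proof. by apply/tensP; rewrite tens_repr. Qed.

Definition scale_seq (b : B) (s : seq (B * H)) := [seq (b * p.1, p.2) | p <- s].

Lemma scale_seq_eq b s t : tensor_eq s t -> tensor_eq (scale_seq b s) (scale_seq b t).
Proof.
elim=> {s t} /=.
- by move=> s; exact: tensor_refl.
- by move=> s t _; exact: tensor_sym.
- by move=> s t u _ + _; exact: tensor_trans.
- by move=> s s' t t' _ ss' _ tt'; rewrite /scale_seq !map_cat; exact: tensor_cat.
- by move=> s t; rewrite /scale_seq !map_cat; exact: tensor_catC.
- by move=> h; rewrite mulr0; exact: tensor_0l.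
- by move=> c c' h; rewrite mulrDr; exact: tensor_Dl.
- by move=> c h h'; exact: tensor_Dr.
- by move=> c a h; rewrite mulrA; exact: tensor_bal.
Qed.

Definition tensor_add (x y : tensor) := tens (repr x ++ repr y).
Definition tensor_scale (b : B) (x : tensor) := tens (scale_seq b (repr x)).

Lemma tens_add s t : tensor_add (tens s) (tens t) = tens (s ++ t).
Proof. by apply/tensP/tensor_cat; exact: repr_tens. Qed.

Lemma tens_scale b s : tensor_scale b (tens s) = tens (scale_seq b s).
Proof. by apply/tensP/scale_seq_eq/repr_tens. Qed.

Lemma tensor_addA : associative tensor_add.
Proof.
move=> x y z; rewrite -(tens_repr x) -(tens_repr y) -(tens_repr z).
by rewrite !tens_add catA.
Qed.

Lemma tensor_addC : commutative tensor_add.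
Proof. by move=> x y; apply/tensP/tensor_catC. Qed.

Lemma tensor_add0 : left_id (tens [::]) tensor_add.
Proof. by move=> x; rewrite -(tens_repr x) tens_add. Qed.

Lemma tensor_addN : left_inverse (tens [::]) (tensor_scale (- 1)) tensor_add.
Proof.
move=> x; rewrite -(tens_repr x) tens_scale tens_add.
elim: (repr x) => [//|[b h] s IHs] /=.
set S := scale_seq _ _ in IHs *.
have -> : tens ((- 1 * b, h) :: S ++ (b, h) :: s) =
    tensor_add (tens [:: (- 1 * b, h)])
      (tensor_add (tens [:: (b, h)]) (tensor_add (tens S) (tens s))).
  rewrite !tens_add; apply/tensP; rewrite -cat1s.
  apply: tensor_cat; first exact: tensor_refl.
  rewrite -[(b, h) :: s]cat1s !catA.
  by apply: tensor_cat; [exact: tensor_catC|exact: tensor_refl].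
rewrite [tensor_add (tens S) _]tens_add IHs !tens_add; apply/tensP => /=.
rewrite mulN1r; apply: tensor_trans (tensor_sym (tensor_Dl _ _ _)) _.
by rewrite addNr; exact: tensor_0l.
Qed.

HB.instance Definition _ :=
  GRing.isZmodule.Build tensor tensor_addA tensor_addC tensor_add0 tensor_addN.

Lemma tensor_scaleA b c x :
  tensor_scale b (tensor_scale c x) = tensor_scale (b * c) x.
Proof.
rewrite -(tens_repr x) !tens_scale /scale_seq -map_comp.
by congr tens; apply: eq_map => p /=; rewrite mulrA.
Qed.

Lemma tensor_scale1 : left_id 1 tensor_scale.
Proof.
move=> x; rewrite -(tens_repr x) tens_scale /scale_seq.
by congr tens; rewrite -[RHS]map_id; apply: eq_map => -[b h] /=; rewrite mul1r.
Qed.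

Lemma tensor_scaleDr : right_distributive tensor_scale +%R.
Proof.
move=> b x y; rewrite -(tens_repr x) -(tens_repr y).
rewrite -[_ + _]/(tensor_add _ _) -[RHS]/(tensor_add _ _).
by rewrite tens_add !tens_scale tens_add /scale_seq map_cat.
Qed.

Lemma tensor_scaleDl x : {morph tensor_scale^~ x : b c / b + c}.
Proof.
move=> b c; rewrite -[RHS]/(tensor_add _ _) -(tens_repr x) !tens_scale tens_add.
elim: (repr x) => [//|[d h] s IHs] /=.
rewrite -cat1s -tens_add IHs tens_add.
rewrite -tens_add mulrDl (_ : tens [:: _] = tens [:: (b * d, h); (c * d, h)]).
  rewrite !tens_add; apply/tensP => /=.
  rewrite -cat1s -[X in tensor_eq _ X]cat1s; apply: tensor_cat; first exact: tensor_refl.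
  rewrite -cat1s -[X in tensor_eq _ (_ ++ X)]cat1s !catA.
  by apply: tensor_cat; [exact: tensor_catC|exact: tensor_refl].
by apply/tensP/tensor_Dl.
Qed.

HB.instance Definition _ := GRing.Zmodule_isLmodule.Build B tensor
  tensor_scaleA tensor_scale1 tensor_scaleDr tensor_scaleDl.

Context (V : lmodType B) (phi : {linear H -> V | f \; *:%R}).

Definition eval_seq (s : seq (B * H)) : V := \sum_(p <- s) p.1 *: phi p.2.

(** The map [1 (x) phi], characterised by [extend_pure] and [extend_linear]. *)
Definition extend (x : tensor) : V := eval_seq (repr x).

Lemma eval_seq_eq s t : tensor_eq s t -> eval_seq s = eval_seq t.
Proof.
rewrite /eval_seq; elim=> {s t}.
- by [].
- by move=> s t _ ->.
- by move=> s t u _ -> _ ->.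
- by move=> s s' t t' _ ss' _ tt'; rewrite !big_cat/= ss' tt'.
- by move=> s t; rewrite !big_cat/= addrC.
- by move=> h; rewrite big_seq1 big_nil scale0r.
- by move=> b b' h; rewrite big_seq1 big_cons big_seq1 scalerDl.
- by move=> b h h'; rewrite big_seq1 big_cons big_seq1 /= linearD scalerDr.
- by move=> b a h; rewrite !big_seq1 /= linearZ /= scalerA.
Qed.

Lemma extend_tens s : extend (tens s) = eval_seq s.
Proof. exact/eval_seq_eq/repr_tens. Qed.

Lemma extend_pure b h : extend (pure b h) = b *: phi h.
Proof. by rewrite extend_tens /eval_seq big_seq1. Qed.

Lemma extend_linear : linear extend.
Proof.
move=> b x y; rewrite -(tens_repr x) -(tens_repr y).
rewrite -[b *: _ + _]/(tensor_add (tensor_scale b _) _) tens_scale tens_add.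
rewrite !extend_tens /eval_seq big_cat/= big_map scaler_sumr; congr (_ + _).
by apply: eq_bigr => p _; rewrite scalerA.
Qed.
HB.instance Definition _ :=
  GRing.isLinear.Build B tensor V *:%R extend extend_linear.

End Tensor.

Section Torsion.
Context (R : realType) (Gamma : zmodClosed R) (K : fieldType).
Context (H : lmodType (Lambda Gamma K)).

Definition torsion : {pred H} :=
  fun x => `[< exists2 a : Lambda Gamma K, a != 0 & a *: x = 0 >].

Lemma torsion_zmod_closed : zmod_closed torsion.
Proof.
split; first by apply/asboolP; exists 1; rewrite ?oner_eq0// scaler0.
move=> x y /asboolP[a a0 ax] /asboolP[b b0 bY].
apply/asboolP; exists (a * b); first exact: Lambda_mul_neq0.
by rewrite scalerBr -[in X in _ - X]scalerA bY mulrC -scalerA ax !scaler0 subr0.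
Qed.
HB.instance Definition _ := GRing.isZmodClosed.Build H torsion torsion_zmod_closed.

Lemma torsionZ a x : x \in torsion -> a *: x \in torsion.
Proof.
move=> /asboolP[b b0 bx]; apply/asboolP; exists b => //.
by rewrite scalerA mulrC -scalerA bx scaler0.
Qed.

(** The quotient module [H/tH]. *)
Definition mod_torsion := Quotient.quot torsion.
HB.instance Definition _ := GRing.Zmodule.on mod_torsion.

Definition proj_torsion (x : H) : mod_torsion := \pi_(Quotient.quot torsion)%qT x.

Lemma proj_torsionP x y : proj_torsion x = proj_torsion y <-> x - y \in torsion.
Proof.
rewrite /proj_torsion; split=> [/eqP|xy]; first by rewrite -Quotient.idealrBE.
by apply/eqP; rewrite -Quotient.idealrBE.
Qed.

Lemma proj_torsionD x y : proj_torsion (x + y) = proj_torsion x + proj_torsion y.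
Proof. exact: Quotient.pi_add. Qed.

Definition mod_torsion_scale (a : Lambda Gamma K) (x : mod_torsion) : mod_torsion :=
  proj_torsion (a *: repr x).

Lemma proj_torsion_repr (x : mod_torsion) : proj_torsion (repr x) = x.
Proof. exact: reprK. Qed.

Lemma proj_torsionZ a x : mod_torsion_scale a (proj_torsion x) = proj_torsion (a *: x).
Proof.
apply/proj_torsionP; rewrite -scalerBr; apply: torsionZ.
by apply/proj_torsionP; rewrite proj_torsion_repr.
Qed.

Lemma mod_torsion_scaleA a b x :
  mod_torsion_scale a (mod_torsion_scale b x) = mod_torsion_scale (a * b) x.
Proof. by rewrite -(proj_torsion_repr x) !proj_torsionZ scalerA. Qed.

Lemma mod_torsion_scale1 : left_id 1 mod_torsion_scale.
Proof. by move=> x; rewrite -(proj_torsion_repr x) proj_torsionZ scale1r. Qed.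

Lemma mod_torsion_scaleDr : right_distributive mod_torsion_scale +%R.
Proof.
move=> a x y; rewrite -(proj_torsion_repr x) -(proj_torsion_repr y).
by rewrite -proj_torsionD !proj_torsionZ scalerDr proj_torsionD.
Qed.

Lemma mod_torsion_scaleDl x : {morph mod_torsion_scale^~ x : a b / a + b}.
Proof.
move=> a b; rewrite -(proj_torsion_repr x) !proj_torsionZ.
by rewrite scalerDl proj_torsionD.
Qed.

HB.instance Definition _ := GRing.Zmodule_isLmodule.Build (Lambda Gamma K) mod_torsion
  mod_torsion_scaleA mod_torsion_scale1 mod_torsion_scaleDr mod_torsion_scaleDl.

End Torsion.
Arguments torsion {R Gamma K} H _.

Section MatchedPairs.
Context (R : realType) (Gamma : zmodClosed R) (K : fieldType).
Local Notation L := (Lambda Gamma K).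
Local Notation Lup := (Lambda_up Gamma K).
Local Notation Ldown := (Lambda_down Gamma K).
Local Open Scope ereal_scope.

Record normed_up := NormedUp {
  space_up :> vectType Lup;
  rho_up : space_up -> \bar R;
  rho_up_lt_pinfty : forall x, rho_up x < +oo;
  rho_up_eqNy : forall x, rho_up x = -oo <-> x = 0%R;
  rho_upZ : forall a x, rho_up (a *: x)%R = rho_up x - nu_up a;
  rho_upD : forall x y, rho_up (x + y)%R <= maxe (rho_up x) (rho_up y) }.

Record normed_down := NormedDown {
  space_down :> vectType Ldown;
  rho_down : space_down -> \bar R;
  rho_down_gt_ninfty : forall x, -oo < rho_down x;
  rho_down_eqy : forall x, rho_down x = +oo <-> x = 0%R;
  rho_downZ : forall a x, rho_down (a *: x)%R = rho_down x - nu_down a;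
  rho_downD : forall x y, mine (rho_down x) (rho_down y) <= rho_down (x + y)%R }.

Definition orthogonal_up (V : normed_up) d (x : 'I_d -> V) : Prop :=
  forall l : 'I_d -> Lup,
    rho_up (\sum_(i < d) l i *: x i)%R =
    \big[maxe/-oo]_(i < d) (rho_up (x i) - nu_up (l i)).

Definition orthogonal_down (V : normed_down) d (x : 'I_d -> V) : Prop :=
  forall l : 'I_d -> Ldown,
    rho_down (\sum_(i < d) l i *: x i)%R =
    \big[mine/+oo]_(i < d) (rho_down (x i) - nu_down (l i)).

Definition finitely_generated (H : lmodType L) : Prop :=
  exists (n : nat) (h : 'I_n -> H), forall x : H,
    exists c : 'I_n -> L, x = (\sum_(i < n) c i *: h i)%R.

Definition module_basis (A : nzRingType) (M : lmodType A) d (e : 'I_d -> M) :=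
  forall x : M, exists! c : {ffun 'I_d -> A}, x = (\sum_(i < d) c i *: e i)%R.

(** [extend phi] is [1 (x) phi]; being linear, it is an isomorphism as soon as
    it is bijective. *)
Record matched_pair (H : lmodType L) := MatchedPair {
  pair_fg : finitely_generated H;
  pair_up : normed_up;
  pair_down : normed_down;
  phi_up : {linear H -> pair_up | @to_up R Gamma K \; *:%R};
  phi_down : {linear H -> pair_down | @to_down R Gamma K \; *:%R};
  extend_up_bij : bijective (extend phi_up);
  extend_down_bij : bijective (extend phi_down) }.

Context (H : lmodType L).
Implicit Types P Q : matched_pair H.

Definition doubly_orthogonal_basis P d (e : 'I_d -> H) : Prop :=
  [/\ module_basis (fun i => proj_torsion (e i)),
      basis_of fullv [seq phi_up P (e i) | i <- enum 'I_d] /\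
        orthogonal_up (fun i => phi_up P (e i)) &
      basis_of fullv [seq phi_down P (e i) | i <- enum 'I_d] /\
        orthogonal_down (fun i => phi_down P (e i)) ].

Definition spectrum_type : choiceType := (Quotient.quot Gamma * R)%type.

Definition spectrum_of P d (e : 'I_d -> H) : {mset spectrum_type}%mset :=
  seq_mset [seq let a := fine (rho_up (phi_up P (e i))) in
                let b := fine (rho_down (phi_down P (e i))) in
                (\pi_(Quotient.quot Gamma)%qT a, (b - a)%R) : spectrum_type
           | i <- enum 'I_d].

(** The basis spectrum is the multiset [S] below: all doubly-orthogonal bases of
    [P] have the same spectrum, and one exists when [Gamma] is discrete (the
    value [mset0] is used if there is none). *)
Definition basis_spectrum P : {mset spectrum_type}%mset :=
  xget mset0 [set S | exists d (e : 'I_d -> H),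
    doubly_orthogonal_basis P e /\ S = spectrum_of P e].

Record t_morphism (t : R) P Q := TMorphism {
  alpha_up : {linear pair_up P -> pair_up Q};
  alpha_down : {linear pair_down P -> pair_down Q};
  alpha_up_bij : bijective alpha_up;
  alpha_down_bij : bijective alpha_down;
  alpha_up_phi : forall x, phi_up Q x = alpha_up (phi_up P x);
  alpha_down_phi : forall x, phi_down Q x = alpha_down (phi_down P x);
  alpha_up_close : forall x, x \notin torsion H ->
    `|rho_up (phi_up P x) - rho_up (phi_up Q x)| <= t%:E;
  alpha_down_close : forall x, x \notin torsion H ->
    `|rho_down (phi_down P x) - rho_down (phi_down Q x)| <= t%:E }.
End MatchedPairs.

(** The elements of a multiset are counted with multiplicity, through the
    positions in its enumeration. *)
Definition strong_matching (R : realType) (Gamma : zmodClosed R) (t : R)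
    (S T : {mset spectrum_type Gamma}%mset) : Prop :=
  exists2 sigma : 'I_(size S) -> 'I_(size T), bijective sigma &
    forall (i : 'I_(size S)) (a l b m : R),
      tnth (in_tuple S) i = (\pi_(Quotient.quot Gamma)%qT a, l) ->
      tnth (in_tuple T) (sigma i) = (\pi_(Quotient.quot Gamma)%qT b, m) ->
      exists2 g, g \in Gamma & `|g + b - a| <= t /\ `|(g + b + m) - (a + l)| <= t.

Definition finitely_generated_subgroup (R : realType) (Gamma : zmodClosed R) : Prop :=
  exists (n : nat) (b : 'I_n -> R), forall x : R,
    x \in Gamma <-> exists c : 'I_n -> int, x = \sum_(i < n) b i *~ c i.

Definition discrete_subgroup (R : realType) (Gamma : zmodClosed R) : Prop :=
  [set` Gamma] `<=` isolated [set` Gamma].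

(* Main.v *)
Require Import Defs.
From HB Require Import structures.
From mathcomp Require Import all_boot all_order all_algebra.
From mathcomp Require Import perm.
From mathcomp Require Import generic_quotient ring_quotient.
From mathcomp Require Import finmap multiset.
From mathcomp Require Import all_classical all_reals.
From mathcomp Require Import ereal topology normedtype.
From mathcomp Require Import lra ring.

Set Implicit Arguments.
Unset Strict Implicit.
Unset Printing Implicit Defensive.

Import Order.TTheory GRing.Theory Num.Theory.
Import numFieldNormedType.Exports.

(** Let [e] and [f] be doubly-orthogonal bases of [P] and [Q], put
    [a_i = rho_up e_i], [a'_i = rho_down e_i] for [P] and similarly [b_j], [b'_j]
    for [f] and [Q], and expand [e_i = \sum_j B_ij f_j], [f_j = \sum_i C_ji e_i]
    modulo torsion.  By orthogonality ([orthogonal_entry]) and the closeness of the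
    norms, each exponent [g] of [B_ij] satisfies [b_j - g <= a_i + t] and
    [a'_i - t <= b'_j - g], and each exponent [h] of [C_ji] the symmetric
    inequalities.  Call [i] and [j]
    matchable when some [g] in [Gamma] has [|g + b_j - a_i| <= t] and
    [|g + b'_j - a'_i| <= t].  If [j] is matchable neither with [i] nor with [i'],
    while [B_ij] and [C_ji'] do not vanish, then [a_i - a'_i] exceeds
    [a_i' - a'_i'] ([unmatchable_order]).  Thus for a set [S] of indices with
    neighbourhood [N], the product of the blocks [B_SN] and [C_NS] is unitriangular
    with respect to the order by [a - a'], which forces [#|S| <= #|N|]
    ([matchable_hall]); Hall's marriage theorem then gives the strong matching.
    This part holds for every [Gamma].

    The basis spectrum is defined through some doubly-orthogonal basis, so one has
    to exist when [Gamma] is discrete.  It is constructed greedily: [e_k]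
    minimizes the cost [rho_up - rho_down] among the elements outside the rational
    span of [e_0, ..., e_{k-1}] ([greedy]).
    - The minimum is attained.  The cost is bounded below, because the coordinates
      in a finite-dimensional normed space over a complete field are bounded by
      the norm ([norm_bounds_coordinates]), and its values lie in finitely many
      cosets of the discrete group [Gamma] ([rho_cosets]).
    - A greedy family is orthogonal for both norms ([greedy_orthogonal]): if there
      were cancellation in a combination of the [e_i], the leading monomials of its
      dominant terms would give an element of [H] cheaper than the last [e_i]
      involved.
    - A maximal greedy family generates [H] modulo torsion ([greedy_generates]):
      given [x], subtract from it the terms of exponent below [rho_up e_i] of its
      upward coordinates and those of exponent at least [rho_up e_i] of its
      downward coordinates; the remainder is cheaper than the last [e_i] that it
      involves, hence torsion.

    The upward and downward halves of a matched pair play symmetric roles under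
    [T |-> T^-1], and are treated together as instances of a structure [side]. *)

(** * Hall's marriage theorem *)

Section Hall.
(* The notions on finite sets hide those on sets in the sense of predicates. *)
Import mathcomp.boot.fintype mathcomp.boot.finset.
Context (A B : finType) (r : A -> B -> bool).

(** The elements of [B] related to some element of [S]. *)
Definition neighbours (S : {set A}) : {set B} := [set y | [exists x in S, r x y]].

Lemma neighboursS (S T : {set A}) : S \subset T -> neighbours S \subset neighbours T.
Proof.
move=> /subsetP ST; apply/subsetP => y; rewrite !inE => /existsP[x /andP[/ST xT rxy]].
by apply/existsP; exists x; rewrite xT.
Qed.

Lemma neighboursU (S T : {set A}) :
  neighbours (S :|: T) = neighbours S :|: neighbours T.
Proof.
apply/eqP; rewrite eqEsubset subUset !neighboursS ?subsetUl ?subsetUr// !andbT.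
apply/subsetP => y; rewrite !inE => /existsP[x /andP[]]; rewrite inE.
by move=> /orP[xS|xT] rxy; apply/orP; [left|right]; apply/existsP; exists x;
  apply/andP.
Qed.

(** The marriage theorem for matching [X] into [Y]; the values outside [X] are
    irrelevant, [b0] only serves to have some. *)
Lemma hall_on (b0 : B) (X : {set A}) (Y : {set B}) :
  (forall S : {set A}, S \subset X -> #|S| <= #|neighbours S :&: Y|) ->
  exists f : A -> B, {in X &, injective f} /\
    forall x, x \in X -> f x \in Y /\ r x (f x).
Proof.
have [n] := ubnP #|X|; elim: n X Y => // n IHn X Y /ltnSE-leXn hallX.
have [->|[x xX]] := set_0Vmem X.
  by exists (fun=> b0); split=> [x y|x]; rewrite inE.
have [tight|/existsPn loose] :=
    boolP [exists S : {set A}, [&& S \subset X, S != set0, S != X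
      & #|neighbours S :&: Y| <= #|S|]].
  (* A critical set [S] and its complement can be matched separately. *)
  case/existsP: tight => S /and4P[SX S0 neSX critS].
  have ltS : #|S| < n.
    by apply: leq_trans leXn; apply: proper_card; rewrite properEneq neSX.
  have ltXS : #|X :\: S| < n.
    apply: leq_trans leXn; apply: proper_card; rewrite properEneq subsetDl andbT.
    apply/eqP => XS; case/set0Pn: S0 => z zS.
    by move: (subsetP SX _ zS); rewrite -XS inE zS.
  have [|f [f_inj fP]] := IHn S (Y :&: neighbours S) ltS.
    move=> T TS; rewrite setIC -setIA [neighbours S :&: _](setIidPr (neighboursS TS)).
    by rewrite setIC; apply: hallX; exact: subset_trans TS SX.
  have [|g [g_inj gP]] := IHn (X :\: S) (Y :\: neighbours S) ltXS.
    move=> T TXS; have TX : T :|: S \subset X.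
      by rewrite subUset SX (subset_trans TXS) ?subsetDl.
    have dTS : #|T :|: S| = #|T| + #|S|.
      rewrite cardsU (_ : T :&: S = set0) ?cards0 ?subn0//.
      apply/setP => z; rewrite !inE; apply/negP => /andP[/(subsetP TXS)].
      by rewrite inE => /andP[/negP].
    rewrite -(leq_add2r #|S|) -dTS; apply: leq_trans (hallX _ TX) _.
    rewrite neighboursU; apply: (@leq_trans #|(neighbours T :&: (Y :\: neighbours S))
      :|: (neighbours S :&: Y)|).
      apply/subset_leq_card/subsetP => z; rewrite !inE.
      by case: [exists x0 in S, _]; case: [exists x0 in T, _]; case: (z \in Y).
    by apply: leq_trans (leq_card_setU _ _) _; rewrite leq_add2l.
  exists (fun z => if z \in S then f z else g z).
  have inXS z : z \in X -> z \notin S -> z \in X :\: S by rewrite inE => -> ->.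
  split=> [z z' zX z'X|z zX]; last first.
    case: ifPn => zS.
      by have [/setIP[]] := fP z zS.
    by have [/setDP[]] := gP z (inXS _ zX zS).
  case: ifPn => zS; case: ifPn => z'S.
  - exact: f_inj.
  - move=> E; have [/setDP[_ /negP[]]] := gP z' (inXS _ z'X z'S).
    by rewrite -E; have [/setIP[]] := fP z zS.
  - move=> E; have [/setDP[_ /negP[]]] := gP z (inXS _ zX zS).
    by rewrite E; have [/setIP[]] := fP z' z'S.
  - by apply: g_inj; exact: inXS.
(* Without critical sets, any choice for one element can be completed. *)
have : 0 < #|neighbours [set x] :&: Y|.
  by apply: leq_trans (hallX [set x] _); rewrite ?cards1 ?sub1set.
rewrite card_gt0 => /set0Pn[y /setIP[]].
rewrite inE => /existsP[_ /andP[/set1P-> rxy]] yY.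
have ltX : #|X :\ x| < n by rewrite (leq_trans _ leXn)// [in leqRHS](cardsD1 x X) xX.
have [|f [f_inj fP]] := IHn (X :\ x) (Y :\ y) ltX.
  move=> T TX; have [->|T0] := eqVneq T set0; first by rewrite cards0.
  have /subsetP TX' := TX.
  move: (loose T); rewrite T0 (subset_trans TX) ?subsetDl//= negb_and -ltnNge.
  case/orP => [|ltT].
    by rewrite negbK => /eqP TeX; move: (TX' x); rewrite TeX xX !inE eqxx => /(_ isT).
  rewrite -ltnS; apply: leq_trans ltT _.
  rewrite (cardsD1 y) setIDA addnC.
  by rewrite -addn1 leq_add2l leq_b1.
exists (fun z => if z == x then y else f z).
have inXx z : z \in X -> z != x -> z \in X :\ x by rewrite !inE => -> ->.
split=> [z z' zX z'X|z zX]; last first.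
  case: eqVneq => [->|zx]; first by split.
  by have [/setD1P[]] := fP z (inXx _ zX zx).
case: eqVneq => [->|zx]; case: eqVneq => [->//|z'x].
- by move=> E; have [/setD1P[/negP[]]] := fP z' (inXx _ z'X z'x); rewrite E.
- by move=> E; have [/setD1P[/negP[]]] := fP z (inXx _ zX zx); rewrite E.
- by apply: f_inj; exact: inXx.
Qed.

(** Hall's marriage theorem. *)
Lemma hall : (forall S : {set A}, #|S| <= #|neighbours S|) ->
  exists2 f : A -> B, injective f & forall x, r x (f x).
Proof.
move=> hallA; have [x _|A0] := pickP (@predT A); last first.
  have absurdA (x : A) : False by have := A0 x.
  by exists (fun x => match absurdA x with end) => x; case: (absurdA x).
have /card_gt0P[b0 _] : 0 < #|neighbours [set x]| by rewrite (leq_trans _ (hallA _)) ?cards1.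
have [|f [f_inj fP]] := @hall_on b0 setT setT.
  by move=> S _; rewrite setIT.
by exists f => [y z|y]; [apply: f_inj; rewrite inE|have [] := fP y (in_setT y)].
Qed.
End Hall.

Local Open Scope classical_set_scope.
Local Open Scope ring_scope.

(** * Discrete subgroups of the reals *)

Section Discrete.
Context (R : realType) (Gamma : zmodClosed R).

(** The nonzero elements of a discrete subgroup are bounded away from zero. *)
Lemma discrete_gap : discrete_subgroup Gamma ->
  exists2 eps : R, 0 < eps & forall g, g \in Gamma -> g != 0 -> eps <= `|g|.
Proof.
move=> /(_ 0 (rpred0 Gamma)) [_ [V]].
move=> /nbhs_ballP[e /= e0 eV] VG; exists e => // g gG g0.
rewrite leNgt; apply/negP => ge.
have : (V `&` [set` Gamma]) g by split=> //; apply: eV; rewrite /ball/= sub0r normrN.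
by rewrite VG => /eqP; apply/negP.
Qed.

(** [A] is contained in the union of the cosets of [Gamma] given by [s]. *)
Definition coset_covered (s : seq R) (A : set R) : Prop :=
  forall x, A x -> exists2 r, r \in s & x - r \in Gamma.

(** Each coset of a discrete group is uniformly separated, so that a set of reals
    that is bounded below and meets finitely many cosets only has a minimum. *)
Lemma coset_covered_min (s : seq R) (A : set R) (C x : R) :
  discrete_subgroup Gamma -> coset_covered s A -> A x ->
  (forall y, A y -> C <= y) -> exists2 m, A m & forall y, A y -> m <= y.
Proof.
move=> /discrete_gap[eps eps0 gap].
elim: s A x => [A x covA Ax _|r s IHs A x covA Ax lbA]; first by have [] := covA x Ax.
pose B := A `&` [set y | y - r \in Gamma]; pose D := A `&` [set y | y - r \notin Gamma].
have minB y : B y -> exists2 m, B m & forall z, B z -> m <= z.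
  move=> By; have infB : has_inf B by split; [exists y|exists C => z [/lbA]].
  have [m Bm mlt] := inf_adherent eps0 infB.
  exists m => // z Bz; rewrite leNgt; apply/negP => zm.
  have Gmz : m - z \in Gamma.
    have -> : m - z = (m - r) - (z - r) by lra.
    by rewrite rpredB//; [case: Bm|case: Bz].
  have /gap : m - z != 0 by lra.
  move=> /(_ Gmz); rewrite ger0_norm; last by lra.
  by have := ge_inf infB.2 Bz; lra.
have minD y : D y -> exists2 m, D m & forall z, D z -> m <= z.
  move=> Dy; apply: (IHs D y) => // [z [Az /negP zG]|z [/lbA]//].
  have [r'] := covA z Az; rewrite inE => /orP[/eqP->|]; first by [].
  by exists r'.
have splitA z : A z -> B z \/ D z.
  by move=> Az; case: (boolP (z - r \in Gamma)); [left|right].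
have [[b Bb]|/forallNP B0] := pselect (exists b, B b); last first.
  have [//|m [Am _] mP] := minD x; first by case: (splitA x Ax) => // /B0.
  by exists m => // y /splitA[/B0//|/mP].
have [b' [Ab' _] b'P] := minB b Bb.
have [[d Dd]|/forallNP D0] := pselect (exists d, D d); last first.
  by exists b' => // y /splitA[/b'P//|/D0].
have [d' [Ad' _] d'P] := minD d Dd.
exists (Num.min b' d') => [|y /splitA[/b'P|/d'P] H].
- by rewrite /Num.min; case: ifP.
- by rewrite ge_min H.
- by rewrite ge_min H orbT.
Qed.
End Discrete.

(** * Independent families in finitely generated modules *)

Section Independent.
Context (R : realType) (Gamma : zmodClosed R) (K : fieldType).
Local Notation L := (Lambda Gamma K).
Context (H : lmodType L).

Lemma Lambda_prod_neq0 (I : Type) (r : seq I) (P : pred I) (a : I -> L) :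
  (forall i, P i -> a i != 0) -> \prod_(i <- r | P i) a i != 0.
Proof.
by move=> a0; elim/big_ind: _ => //; [exact: oner_neq0|exact: Lambda_mul_neq0].
Qed.

(** Linear independence over the group algebra. *)
Definition independent d (h : 'I_d -> H) : Prop :=
  forall c : 'I_d -> L, \sum_(i < d) c i *: h i = 0 -> forall i, c i = 0.

(** A finitely generated module over the domain [L] is, up to one common
    denominator [a], spanned by an independent family. *)
Lemma fg_independent_span : finitely_generated H ->
  exists d (h : 'I_d -> H) (a : L), [/\ a != 0, independent h &
    forall x : H, exists c : 'I_d -> L, a *: x = \sum_(i < d) c i *: h i].
Proof.
move=> [n [g gP]].
pose on (I : {set 'I_n}) (c : 'I_n -> L) := forall i, i \notin I -> c i = 0.
pose indep (I : {set 'I_n}) : bool := `[< forall c, on I c ->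
  \sum_(i < n) c i *: g i = 0 -> forall i, c i = 0 >].
have [|I /maxsetP[/asboolP indI maxI]] := @ex_maxset _ indep.
  by exists finset.set0; apply/asboolP => c c0 _ i; apply: c0; rewrite inE.
(* By maximality of [I], a nonzero multiple of each generator is a combination of
   the generators indexed by [I]. *)
have dep j : exists ac : L * ('I_n -> L), [/\ ac.1 != 0, on I ac.2 &
    ac.1 *: g j = \sum_(i < n) ac.2 i *: g i].
  have [jI|jI] := boolP (j \in I).
    exists (1, fun i => (i == j)%:R); split=> /= [|i iI|]; first exact: oner_neq0.
      by case: eqVneq iI => // ->; rewrite jI.
    rewrite (bigD1 j)//= eqxx big1 ?addr0// => i /negPf->.
    by rewrite scale0r.
  have /asboolPn/existsNP[c] : ~~ indep (j |: I)%SET.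
    apply/negP => /maxI; rewrite finset.subsetUr => /(_ isT) jII.
    by move: jI; rewrite -jII !inE eqxx.
  move=> /not_implyP[conj /not_implyP[csum /existsNP[i0 /eqP ci0]]].
  have conI : c j = 0 -> on I c.
    move=> cj0 i iI; have [->//|ij] := eqVneq i j.
    by apply: conj; rewrite !inE negb_or ij.
  have cj0 : c j != 0.
    by apply: contra_neq ci0 => cj0; exact: indI (conI cj0) csum _.
  exists (c j, fun i => if i == j then 0 else - c i); split=> //= [i iI|].
    by case: eqVneq => // ij; rewrite conj ?oppr0// !inE negb_or ij.
  move: csum; rewrite (bigD1 j)//= => /eqP; rewrite addr_eq0 => /eqP ->.
  rewrite -sumrN [RHS](bigD1 j)//= eqxx scale0r add0r; apply: eq_bigr => i /negPf->.
  by rewrite scaleNr.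
have [ac acP] := choice dep.
pose a := \prod_(j < n) (ac j).1.
(* The product of these multipliers is the common denominator. *)
exists #|I|, (fun k => g (enum_val k)), a.
have sumI c : on I c -> \sum_(i < n) c i *: g i =
    \sum_(k < #|I|) c (enum_val k) *: g (enum_val k).
  move=> con; rewrite -(big_enum_val (fun i => c i *: g i)) [LHS](bigID (mem I))/=.
  by rewrite [X in _ + X]big1 ?addr0// => i /con->; rewrite scale0r.
split.
- by apply: Lambda_prod_neq0 => j _; have [] := acP j.
- move=> c csum k; pose c' i := \sum_(k < #|I| | enum_val k == i) c k.
  have c'E m : c' (enum_val m) = c m.
    by rewrite /c' (eq_bigl (pred1 m)) ?big_pred1_eq// => m'; rewrite (inj_eq enum_val_inj).
  rewrite -c'E; apply: indI => [i iI|].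
    by rewrite /c' big_pred0// => m; apply: contraNF iI => /eqP <-; exact: enum_valP.
  rewrite sumI => [|i iI]; last first.
    by rewrite /c' big_pred0// => m; apply: contraNF iI => /eqP <-; exact: enum_valP.
  by rewrite -[RHS]csum; apply: eq_bigr => m _; rewrite c'E.
- move=> x; have [b ->] := gP x.
  pose c i := \sum_(j < n) b j * (\prod_(k < n | k != j) (ac k).1) * (ac j).2 i.
  have con : on I c.
    by move=> i iI; apply: big1 => j _; have [_ /(_ i iI)->] := acP j; rewrite mulr0.
  exists (fun k => c (enum_val k)); rewrite -(sumI _ con) scaler_sumr.
  under [RHS]eq_bigr do rewrite scaler_suml.
  rewrite exchange_big/=; apply: eq_bigr => j _.
  under [RHS]eq_bigr do rewrite -scalerA.
  rewrite -scaler_sumr; have [_ _ <-] := acP j.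
  by rewrite !scalerA /a (bigD1 j)//= mulrC (mulrC (ac j).1) mulrA.
Qed.
End Independent.

(** * The completions of the group algebra *)

Section NuUp.
Local Open Scope ereal_scope.
Context (R : realType) (Gamma : zmodClosed R) (K : fieldType).
Local Notation Lup := (Lambda_up Gamma K).

Lemma nu_up_geP (r : R) (a : Lup) :
  r%:E <= nu_up a <-> forall g, a g != 0%R -> (r <= g)%R.
Proof.
split=> [ra g ag|ra]; last by apply: le_ereal_inf_tmp => _ [g ag <-]; rewrite lee_fin ra.
by rewrite -lee_fin (le_trans ra)//; apply: ereal_inf_lbound; exists g.
Qed.

Lemma nu_up_gtP (r : R) (a : Lup) :
  r%:E < nu_up a <-> forall g, a g != 0%R -> (r < g)%R.
Proof.
split=> [ra g ag|ra]; last first.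
  have [->|/nu_up_min[m am ->]] := eqVneq a 0%R; first by rewrite nu_up0 ltry.
  by rewrite lte_fin ra.
by rewrite -lte_fin (lt_le_trans ra)//; apply: ereal_inf_lbound; exists g.
Qed.
End NuUp.

Section Completions.
Local Open Scope ereal_scope.
Context (R : realType) (Gamma : zmodClosed R) (K : fieldType).
Local Notation L := (Lambda Gamma K).
Local Notation Lup := (Lambda_up Gamma K).
Local Notation Ldown := (Lambda_down Gamma K).

(** The exponent [g], or its opposite in a reversed completion. *)
Definition signed (b : bool) (g : R) : R := if b then (- g)%R else g.

(** A field containing the group algebra, identified as an additive group with the
    upward completion by [expansion]; under this identification the monomial [T^g]
    becomes [T^g] or [T^-g], according to [reversed]. *)
Record completion := Completion {
  completion_field :> fieldType;
  incl : {rmorphism L -> completion_field};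
  reversed : bool;
  expansion : completion_field -> Lup;
  expansionB : forall a b, expansion (a - b)%R = (expansion a - expansion b)%R;
  expansion_bij : bijective expansion;
  expansion_incl : forall l g, expansion (incl l) g = l (signed reversed g) }.

Definition up_completion : completion := {|
  completion_field := Lup : fieldType;
  incl := @to_up R Gamma K;
  reversed := false;
  expansion := id;
  expansionB := fun _ _ => erefl;
  expansion_bij := inv_bij (fun _ => erefl);
  expansion_incl := fun _ _ => erefl |}.

Lemma flip_down_subproof (a : Ldown) : is_formal_sum Gamma UpSupp (a \o -%R).
Proof.
by apply: flip_is_formal_sum; have /admissible_opp := supp_admissible a.
Qed.

(** The substitution [T |-> T^-1] exchanges the two completions. *)
Definition flip_down (a : Ldown) : Lup := FormalSum (flip_down_subproof a).

Lemma flip_up_subproof (a : Lup) : is_formal_sum Gamma DownSupp (a \o -%R).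
Proof.
apply: flip_is_formal_sum; apply/admissible_opp.
by apply: admissible_sub (supp_admissible a) => g; rewrite /= opprK.
Qed.

Definition flip_up (a : Lup) : Ldown := FormalSum (flip_up_subproof a).

Lemma flip_down_bij : bijective flip_down.
Proof.
by exists flip_up => a; apply: formal_sumP => g /=; rewrite opprK.
Qed.

Lemma nu_up_flip (a : Ldown) : nu_up (flip_down a) = - nu_down a.
Proof.
rewrite /nu_up /nu_down ereal_infEN; congr (- ereal_sup _).
apply/seteqP; split=> [_ [_ [g ag <-] <-]|_ [g ag <-]].
  by exists (- g)%R.
exists (- g)%:E; last by rewrite /= opprK.
by exists (- g)%R => //; rewrite /supp /= opprK.
Qed.

Definition down_completion : completion.
Proof.
refine {|
  completion_field := Ldown : fieldType;
  incl := @to_down R Gamma K;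
  reversed := true;
  expansion := flip_down;
  expansion_bij := flip_down_bij;
  expansion_incl := fun _ _ => erefl |}.
by move=> a b; exact: formal_sumP.
Defined.
End Completions.

Arguments incl {R Gamma K} c.
Arguments reversed {R Gamma K} c.
Arguments expansion {R Gamma K} c.

Section CompletionTheory.
Local Open Scope ereal_scope.
Context (R : realType) (Gamma : zmodClosed R) (K : fieldType).
Context (F : completion Gamma K).
Implicit Types (a b : F) (l : Lambda Gamma K) (r : R).
Local Notation exn := (expansion F).

(** The valuation, positive on the monomials of large exponent in the upward
    completion and on those of very negative exponent in the downward one, where it
    is [- nu_down]. *)
Definition nu a := nu_up (exn a).

Lemma expansion0 : exn 0%R = 0%R.
Proof. by rewrite -[X in exn X](subrr 0%R) expansionB subrr. Qed.

Lemma expansionN a : exn (- a)%R = (- exn a)%R.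
Proof. by rewrite -sub0r expansionB expansion0 sub0r. Qed.

Lemma expansionD a b : exn (a + b)%R = (exn a + exn b)%R.
Proof. by rewrite -[b in LHS]opprK expansionB expansionN opprK. Qed.

Lemma expansion_eq0 a : exn a = 0%R -> a = 0%R.
Proof. by rewrite -expansion0; exact: bij_inj (expansion_bij F) _ _. Qed.

Lemma nu_geP r a : r%:E <= nu a <-> forall g, exn a g != 0%R -> (r <= g)%R.
Proof. exact: nu_up_geP. Qed.

Lemma nu_gtP r a : r%:E < nu a <-> forall g, exn a g != 0%R -> (r < g)%R.
Proof. exact: nu_up_gtP. Qed.

Lemma nu0 : nu 0%R = +oo.
Proof. by rewrite /nu expansion0 nu_up0. Qed.

Lemma nu_min a : a != 0%R -> exists m : R,
  [/\ exn a m != 0%R, m \in Gamma, nu a = m%:E & forall g, exn a g != 0%R -> (m <= g)%R].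
Proof.
move=> a0; have : exn a != 0%R.
  by apply: contra_neq a0; exact: expansion_eq0.
move=> /nu_up_min[m am num]; exists m; split=> //; first exact: supp_Gamma am.
by apply/nu_geP; rewrite /nu num.
Qed.

Lemma nu_finE a : a != 0%R -> nu a = (fine (nu a))%:E.
Proof. by move=> /nu_min[m [_ _ -> _]]. Qed.

Lemma nu_Gamma a : a != 0%R -> fine (nu a) \in Gamma.
Proof. by move=> /nu_min[m [_ mG -> _]]. Qed.

Lemma nuD_ge r a b : r%:E <= nu a -> r%:E <= nu b -> r%:E <= nu (a + b)%R.
Proof.
move=> /nu_geP ra /nu_geP rb; apply/nu_geP => g; rewrite expansionD fsD.
by have [->|/ra//] := eqVneq (exn a g) 0%R; rewrite add0r; exact: rb.
Qed.

Lemma nuD_gt r a b : r%:E < nu a -> r%:E < nu b -> r%:E < nu (a + b)%R.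
Proof.
move=> /nu_gtP ra /nu_gtP rb; apply/nu_gtP => g; rewrite expansionD fsD.
by have [->|/ra//] := eqVneq (exn a g) 0%R; rewrite add0r; exact: rb.
Qed.

Lemma nuN a : nu (- a)%R = nu a.
Proof.
rewrite /nu expansionN /nu_up; congr (ereal_inf (image _ _)).
by apply/seteqP; split=> g; rewrite /supp /= oppr_eq0.
Qed.

Lemma nu_incl_geP r l :
  r%:E <= nu (incl F l) <-> forall g, l g != 0%R -> (r <= signed (reversed F) g)%R.
Proof.
rewrite nu_geP; split=> H g; last first.
  by rewrite expansion_incl => /H; rewrite /signed; case: reversed; rewrite ?opprK.
move=> lg; apply: H; rewrite expansion_incl.
by move: lg; rewrite /signed; case: reversed; rewrite ?opprK.
Qed.

Lemma nu_incl_gtP r l :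
  r%:E < nu (incl F l) <-> forall g, l g != 0%R -> (r < signed (reversed F) g)%R.
Proof.
rewrite nu_gtP; split=> H g; last first.
  by rewrite expansion_incl => /H; rewrite /signed; case: reversed; rewrite ?opprK.
move=> lg; apply: H; rewrite expansion_incl.
by move: lg; rewrite /signed; case: reversed; rewrite ?opprK.
Qed.

Lemma incl_eq0 l : incl F l = 0%R -> l = 0%R.
Proof.
move=> l0; apply: formal_sumP => g.
have := expansion_incl F l (signed (reversed F) g).
by rewrite l0 expansion0 !fs0 /signed; case: reversed; rewrite ?opprK => <-.
Qed.

(** Completeness: a sequence that is Cauchy at a linear rate has a limit. *)
Lemma nu_limit (a : nat -> F) (C : R) :
  (forall N M, (N <= M)%N -> (N%:R - C)%:E <= nu (a N - a M)%R) ->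
  exists b, forall N, (N%:R - C)%:E <= nu (b - a N)%R.
Proof.
move=> cauchy.
have stable N M g : (g < N%:R - C)%R -> (g < M%:R - C)%R -> exn (a N) g = exn (a M) g.
  wlog NM : N M / (N <= M)%N => [th gN gM|gN _].
    by case/orP: (leq_total N M) => ?; [exact: th|apply/esym; exact: th].
  have /nu_geP/(_ g) := cauchy N M NM; rewrite expansionB fsD fsN.
  have [/eqP|_ /(_ isT)] := eqVneq (exn (a N) g - exn (a M) g)%R 0%R.
    by rewrite subr_eq0 => /eqP.
  by rewrite leNgt gN.
pose rk (g : R) : nat := (Num.truncn (g + C)).+1.
have rkP g : (g < (rk g)%:R - C)%R by rewrite ltrBrDr truncnS_gt.
pose f g := exn (a (rk g)) g.
have f_fs : is_formal_sum Gamma UpSupp f.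
  apply/asboolP; split=> [g|G]; first exact: supp_Gamma.
  apply: sub_finite_set (supp_admissible (exn (a (rk G))) G) => g [fg gG].
  split=> //; move: fg; rewrite /supp /= /f (stable _ (rk G))//.
  exact: lt_trans gG _.
have [h _ hK] := expansion_bij F.
exists (h (FormalSum f_fs)) => N; apply/nu_geP => g; rewrite expansionB hK fsD fsN.
apply: contraNle => gN; rewrite subr_eq0; apply/eqP.
exact: stable.
Qed.

(** Truncation of [a] at the exponent [G]: a polynomial [l] collects the terms
    below [G], together with the term of exponent [G] itself when [b] is false. *)
Lemma nu_truncate a (b : bool) (G : R) : exists l,
  (forall g, exn (a - incl F l)%R g != 0%R -> (G < g ?<= if b)%R) /\
  (forall g, l g != 0%R -> (signed (reversed F) g < G ?<= if ~~ b)%R).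
Proof.
set sg := signed (reversed F).
have sgK g : sg (sg g) = g by rewrite /sg /signed; case: reversed; rewrite ?opprK.
pose f g := if (sg g < G ?<= if ~~ b)%R then exn a (sg g) else 0%R.
have f_fs : is_formal_sum Gamma FinSupp f.
  apply/asboolP; split=> [g|].
    rewrite /supp /= /f; case: ifP => _; last by rewrite eqxx.
    move=> /supp_Gamma; rewrite /sg /signed; case: reversed => //.
    by rewrite rpredN.
  have := finite_image sg (supp_admissible (exn a) (G + 1)%R); apply: sub_finite_set.
  move=> g; rewrite /supp /= /f; case: ifPn => [sgG ag|]; last by rewrite eqxx.
  exists (sg g) => //; split=> //=.
  by move: sgG; case: (~~ b) => /= ?; lra.
exists (FormalSum f_fs); split=> g; last first.
  by rewrite /= /f; case: ifPn => //; rewrite eqxx.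
rewrite expansionB fsD fsN expansion_incl -/sg /= /f sgK.
case: ifPn; first by rewrite subrr eqxx.
by case: (b) => /=; rewrite -?leNgt -?ltNge.
Qed.

(** Every nonzero element has a leading monomial. *)
Lemma nu_lead a : a != 0%R -> exists l : Lambda Gamma K, [/\ l != 0%R,
   nu a < nu (a - incl F l)%R &
   forall g, l g != 0%R -> (signed (reversed F) g)%:E = nu a].
Proof.
move=> /nu_min[m [am mG num mP]].
have sG : signed (reversed F) m \in Gamma.
  by rewrite /signed; case: reversed; rewrite ?rpredN.
have ms g : (signed (reversed F) g == signed (reversed F) m) = (g == m).
  by rewrite /signed; case: reversed; rewrite ?eqr_opp.
pose l : Lambda Gamma K := monomial sG (exn a m).
have lE g : l (signed (reversed F) g) = (exn a m *+ (g == m))%R.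
  by rewrite /= ms.
have lP g : l g != 0%R -> signed (reversed F) g = m.
  rewrite /=; have [-> _|] := eqVneq g (signed (reversed F) m); last by rewrite eqxx.
  by rewrite /signed; case: reversed; rewrite ?opprK.
exists l; split; last by move=> g /lP ->; rewrite num.
  apply/eqP => /(congr1 (fun c : Lambda Gamma K => c (signed (reversed F) m))).
  by rewrite lE eqxx fs0 => /eqP; apply/negP.
rewrite num; apply/nu_gtP => g; rewrite expansionB fsD fsN expansion_incl lE.
have [->|gm] := eqVneq g m; first by rewrite subrr eqxx.
by rewrite subr0 => /mP; rewrite le_eqVlt eq_sym (negPf gm).
Qed.

End CompletionTheory.

(** Two completions in which [T^g] has opposite valuations. *)
Section Opposite.
Local Open Scope ereal_scope.
Context (R : realType) (Gamma : zmodClosed R) (K : fieldType).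
Context (F F' : completion Gamma K) (FF' : reversed F' = ~~ reversed F).
Implicit Types (a : F) (l : Lambda Gamma K) (G : R).

Lemma signed_opposite (g : R) : signed (reversed F') g = (- signed (reversed F) g)%R.
Proof. by rewrite FF' /signed; case: (reversed F); rewrite ?opprK. Qed.

(** The error of the truncation has large valuation in [F], and the truncation
    itself has large valuation in [F']. *)
Lemma nu_truncate_ge a G : exists l,
  G%:E <= nu (a - incl F l)%R /\ (- G)%:E < nu (incl F' l).
Proof.
have [l [lge llt]] := nu_truncate a true G; exists l; split; first exact/nu_geP.
by apply/nu_incl_gtP => g /llt; rewrite signed_opposite ltrN2.
Qed.

Lemma nu_truncate_gt a G : exists l,
  G%:E < nu (a - incl F l)%R /\ (- G)%:E <= nu (incl F' l).
Proof.
have [l [lge llt]] := nu_truncate a false G; exists l; split; first exact/nu_gtP.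
by apply/nu_incl_geP => g /llt; rewrite signed_opposite lerN2.
Qed.

Lemma nu_lead_opposite a : a != 0%R -> exists2 l : Lambda Gamma K, l != 0%R &
  nu a < nu (a - incl F l)%R /\ nu (incl F' l) = - nu a.
Proof.
move=> a0; have [l [l0 alt lP]] := nu_lead a0; exists l => //; split=> //.
have l'0 : incl F' l != 0%R by apply: contra_neq l0; exact: incl_eq0.
have [m [lm _ num _]] := nu_min l'0; rewrite num.
rewrite -(lP (signed (reversed F') m)); last by rewrite -expansion_incl.
by rewrite signed_opposite /signed -EFinN; case: (reversed F); rewrite ?opprK.
Qed.

(** The smallest exponent of a polynomial is at most the largest one. *)
Lemma nu_opposite_le0 l : l != 0%R -> nu (incl F l) + nu (incl F' l) <= 0.
Proof.
move=> /fs_neq0[g lg].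
have l0 : incl F l != 0%R.
  by apply/eqP => /incl_eq0 l0; move: lg; rewrite l0 fs0 eqxx.
have l'0 : incl F' l != 0%R.
  by apply/eqP => /incl_eq0 {}l0; move: lg; rewrite l0 fs0 eqxx.
have [m [_ _ num _]] := nu_min l0; have [m' [_ _ num' _]] := nu_min l'0.
have mle : (m <= signed (reversed F) g)%R.
  by have /nu_incl_geP : m%:E <= nu (incl F l); [rewrite num|exact].
have m'le : (m' <= signed (reversed F') g)%R.
  by have /nu_incl_geP : m'%:E <= nu (incl F' l); [rewrite num'|exact].
by move: m'le; rewrite num num' -EFinD lee_fin signed_opposite; lra.
Qed.
End Opposite.

(** * The two sides of a matched pair *)

(** Half of a matched pair: a normed space over a completion, identified with the
    extension of scalars of [H].  The norm is normalized as an upward one, so that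
    it is [- rho_down] on the downward side. *)
Record side (R : realType) (Gamma : zmodClosed R) (K : fieldType)
    (H : lmodType (Lambda Gamma K)) := Side {
  side_completion : completion Gamma K;
  side_space :> vectType side_completion;
  rho : side_space -> \bar R;
  rho_lty : forall x, (rho x < +oo)%E;
  rho_eqNy : forall x, rho x = -oo%E <-> x = 0;
  rhoZ : forall a x, rho (a *: x) = (rho x - nu a)%E;
  rhoD : forall x y, (rho (x + y)%R <= maxe (rho x) (rho y))%E;
  side_map : {linear H -> side_space | incl side_completion \; *:%R};
  side_map_bij : bijective (extend side_map) }.
Arguments rho {R Gamma K H s}.
Arguments side_map {R Gamma K H} s.

Section SideInstances.
Local Open Scope ereal_scope.
Context (R : realType) (Gamma : zmodClosed R) (K : fieldType).
Context (H : lmodType (Lambda Gamma K)) (P : matched_pair H).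

Definition up_side : side H := {|
  side_completion := up_completion Gamma K;
  side_space := pair_up P : vectType (up_completion Gamma K);
  rho := @rho_up _ _ _ (pair_up P);
  rho_lty := @rho_up_lt_pinfty _ _ _ (pair_up P);
  rho_eqNy := @rho_up_eqNy _ _ _ (pair_up P);
  rhoZ := @rho_upZ _ _ _ (pair_up P);
  rhoD := @rho_upD _ _ _ (pair_up P);
  side_map := phi_up P;
  side_map_bij := extend_up_bij P |}.

Definition down_side : side H.
Proof.
refine {|
  side_completion := down_completion Gamma K;
  side_space := pair_down P : vectType (down_completion Gamma K);
  rho := fun x => - @rho_down _ _ _ (pair_down P) x;
  side_map := phi_down P;
  side_map_bij := extend_down_bij P |}.
- by move=> x; rewrite lteNl rho_down_gt_ninfty.
- move=> x; rewrite -rho_down_eqy; split=> [/eqP|->//].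
  by rewrite eqe_oppLR => /eqP.
- move=> a x; rewrite rho_downZ /nu nu_up_flip oppeB ?oppeK//.
  rewrite /adde_def !negb_and.
  have -> : rho_down x != -oo by rewrite gt_eqF ?rho_down_gt_ninfty.
  rewrite /= andbT; apply/orP; right; rewrite eqe_oppLR.
  by have [->|/nu_down_max[m _ ->]//] := eqVneq a 0%R; rewrite nu_down0.
- by move=> x y; rewrite -oppe_min leeN2 rho_downD.
Defined.

End SideInstances.

Section SideTheory.
Local Open Scope ereal_scope.
Context (R : realType) (Gamma : zmodClosed R) (K : fieldType).
Context (H : lmodType (Lambda Gamma K)) (V : side H).
Local Notation F := (side_completion V).
Local Notation phi := (side_map V).
Implicit Types (x y : V) (M : \bar R).

Lemma rho0 : rho (0%R : V) = -oo.
Proof. exact/rho_eqNy. Qed.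

Lemma rho_finE x : x != 0%R -> rho x = (fine (rho x))%:E.
Proof.
move=> x0; rewrite fineK// fin_numE; apply/andP; split; last by rewrite lt_eqF ?rho_lty.
by apply: contra_neq x0 => /rho_eqNy.
Qed.

Lemma rhoN x : rho (- x)%R = rho x.
Proof.
rewrite -scaleN1r rhoZ nuN.
have [->|x0] := eqVneq x 0%R; first by rewrite rho0.
have [m [_ _ num _]] := nu_min (oner_neq0 F).
have := rhoZ 1%R x; rewrite scale1r num (rho_finE x0) -EFinB => -[E].
by congr EFin; rewrite -E.
Qed.

Lemma rho_sum_le I (r : seq I) (P : pred I) (f : I -> V) M :
  (forall i, P i -> rho (f i) <= M) -> rho (\sum_(i <- r | P i) f i)%R <= M.
Proof.
move=> fM; elim/big_ind: _ => [|x y xM yM|//]; first by rewrite rho0 leNye.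
by apply: le_trans (rhoD _ _) _; rewrite ge_max xM.
Qed.

Lemma rho_sum_lt I (r : seq I) (P : pred I) (f : I -> V) M : -oo < M ->
  (forall i, P i -> rho (f i) < M) -> rho (\sum_(i <- r | P i) f i)%R < M.
Proof.
move=> M0 fM; elim/big_ind: _ => [|x y xM yM|//]; first by rewrite rho0.
by apply: le_lt_trans (rhoD _ _) _; rewrite gt_max xM.
Qed.

Lemma rhoB_lt x y M : rho x < M -> rho y < M -> rho (x - y)%R < M.
Proof. by move=> xM yM; apply: le_lt_trans (rhoD _ _) _; rewrite gt_max rhoN xM. Qed.

Lemma rhoB_le x y M : rho x <= M -> rho y <= M -> rho (x - y)%R <= M.
Proof. by move=> xM yM; apply: le_trans (rhoD _ _) _; rewrite ge_max rhoN xM. Qed.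

(** The space is spanned by the image of [H]. *)
Lemma phi_spans x : exists s : seq (F * H), x = (\sum_(p <- s) p.1 *: phi p.2)%R.
Proof.
have [g _ gK] := side_map_bij V.
by exists (repr (g x)); rewrite -[LHS]gK.
Qed.

Lemma side_mapZ a (h : H) : phi (a *: h)%R = (incl F a *: phi h)%R.
Proof. exact: linearZ. Qed.

Lemma side_map_sum n (c : 'I_n -> Lambda Gamma K) (h : 'I_n -> H) :
  phi (\sum_(i < n) c i *: h i)%R = (\sum_(i < n) incl F (c i) *: phi (h i))%R.
Proof. by rewrite linear_sum; apply: eq_bigr => i _; exact: side_mapZ. Qed.

(** By injectivity of [1 (x) phi], a linear relation between elements [phi (h i)]
    holds in the tensor product, hence also for any other semilinear map. *)
Lemma side_map_relation (W : lmodType F) (c : {linear H -> W | incl F \; *:%R})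
    n (l : 'I_n -> F) (h : 'I_n -> H) :
  (\sum_(i < n) l i *: phi (h i))%R = 0%R -> (\sum_(i < n) l i *: c (h i))%R = 0%R.
Proof.
set T : tensor (incl F) H := (\sum_(i < n) l i *: pure (incl F) 1 (h i))%R.
have ext (U : lmodType F) (f : {linear H -> U | incl F \; *:%R}) :
    extend f T = (\sum_(i < n) l i *: f (h i))%R.
  by rewrite /T linear_sum/=; apply: eq_bigr => i _; rewrite linearZ/= extend_pure scale1r.
rewrite -!ext => T0; have -> : T = 0%R.
  by apply: (bij_inj (side_map_bij V)); rewrite T0 linear0.
by rewrite linear0.
Qed.
End SideTheory.

Section SideIndependent.
Context (R : realType) (Gamma : zmodClosed R) (K : fieldType).
Local Notation L := (Lambda Gamma K).
Context (H : lmodType L).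

(** Dividing by the common denominator [a], the elements of [H] acquire
    coordinates with respect to [h] in any completion. *)
Lemma coordinate_map (F : completion Gamma K) d (h : 'I_d -> H) (a : L) :
  a != 0 -> independent h ->
  (forall x : H, exists c : 'I_d -> L, a *: x = \sum_(i < d) c i *: h i) ->
  exists c : {linear H -> 'rV[F]_d | incl F \; *:%R}, forall i j, c (h i) 0 j = (i == j)%:R.
Proof.
move=> a0 indh /choice[p pP].
have puniq x (q : 'I_d -> L) : a *: x = \sum_(i < d) q i *: h i -> p x =1 q.
  move=> xq i; apply/eqP; rewrite -subr_eq0; apply/eqP.
  apply: (indh (fun i => p x i - q i)).
  by under eq_bigr do rewrite scalerBl; rewrite sumrB -pP xq subrr.
have ia0 : incl F a != 0 by apply: contra_neq a0; exact: incl_eq0.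
pose c x := \row_(i < d) (incl F (p x i) / incl F a).
have clin : linear_for (incl F \; *:%R) c.
  move=> k x y; apply/rowP => i; rewrite !mxE /=.
  rewrite (puniq _ (fun i => k * p x i + p y i)) => [|].
    by rewrite rmorphD rmorphM/= mulrDl mulrA.
  under eq_bigr do rewrite scalerDl -scalerA.
  by rewrite big_split/= -scaler_sumr -!pP scalerDr !scalerA mulrC.
pose cL := GRing.isLinear.Build L H 'rV[F]_d (incl F \; *:%R) c clin.
pose c' : {linear H -> 'rV[F]_d | incl F \; *:%R} := HB.pack c cL.
exists c' => i j; rewrite /= mxE (puniq _ (fun j => a *+ (i == j))) => [|].
  by case: eqVneq => _; rewrite ?divff// rmorph0 mul0r.
rewrite (bigD1 i)//= eqxx big1 ?addr0// => k; rewrite eq_sym => /negPf->.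
by rewrite scale0r.
Qed.

Context (V : side H).
Local Notation F := (side_completion V).
Local Notation phi := (side_map V).

Section Basis.
Context d (h : 'I_d -> H) (a : L) (a0 : a != 0) (indh : independent h).
Hypothesis spanh : forall x : H, exists c : 'I_d -> L, a *: x = \sum_(i < d) c i *: h i.

(** A maximal independent family of [H] remains independent in the normed space. *)
Lemma side_map_free (l : 'I_d -> F) :
  \sum_(i < d) l i *: phi (h i) = 0 -> forall i, l i = 0.
Proof.
have [c cP] := coordinate_map F a0 indh spanh.
move=> /(side_map_relation c)/rowP l0 i; have := l0 i.
rewrite summxE mxE (bigD1 i)//= big1 ?mxE ?cP ?eqxx ?mulr1 ?addr0//.
by move=> k /negPf ki; rewrite mxE cP ki mulr0.
Qed.

End Basis.

Hypothesis fgH : finitely_generated H.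

(** The map from [H] kills exactly the torsion. *)
Lemma side_map_eq0 x : phi x = 0 <-> x \in torsion H.
Proof.
split=> [phix0|/asboolP[a a0 ax0]]; last first.
  have := side_mapZ V a x; rewrite ax0 linear0 => /esym/eqP.
  rewrite scaler_eq0 => /orP[/eqP/incl_eq0/eqP|/eqP//].
  by rewrite (negPf a0).
have [d [h [a [a0 indh spanh]]]] := fg_independent_span fgH.
apply/asboolP; exists a => //; have [c cP] := spanh x.
have := side_mapZ V a x; rewrite phix0 scaler0 cP linear_sum /=.
under eq_bigr do rewrite side_mapZ.
move=> /(side_map_free a0 indh spanh) c0.
by rewrite big1// => i _; rewrite (incl_eq0 (c0 i)) scale0r.
Qed.
End SideIndependent.

(** * Norms over a complete field *)

Section NormEquivalence.
Context (R : realType) (Gamma : zmodClosed R) (K : fieldType).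
Context (H : lmodType (Lambda Gamma K)) (V : side H).
Local Notation F := (side_completion V).

Lemma ge_rho_scale (x : V) (a : F) (r g : R) :
  (rho x <= r%:E)%E -> (g%:E <= nu a)%E -> (rho (a *: x) <= (r - g)%:E)%E.
Proof. by move=> xr ga; rewrite rhoZ EFinB leeB. Qed.

Lemma rho_le_real (x : V) : exists r : R, (rho x <= r%:E)%E.
Proof.
have [->|/rho_finE->] := eqVneq x 0; last by exists (fine (rho x)).
by exists 0; rewrite rho0 leNye.
Qed.

Lemma rho_le_family n (v : 'I_n -> V) : exists r : R, forall i, (rho (v i) <= r%:E)%E.
Proof.
have /choice[r rP] := fun i => rho_le_real (v i).
exists (\sum_(i < n) `|r i|) => i; apply: le_trans (rP i) _.
by rewrite lee_fin (bigD1 i)//= ler_wpDr ?sumr_ge0// ler_norm.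
Qed.

(** Over a complete field, the coordinates with respect to an independent family
    are bounded by the norm. *)
Lemma norm_bounds_coordinates n (v : 'I_n -> V) :
  (forall l : 'I_n -> F, \sum_(i < n) l i *: v i = 0 -> forall i, l i = 0) ->
  exists C : R, forall (l : 'I_n -> F) (r : R),
    (rho (\sum_(i < n) l i *: v i) <= r%:E)%E -> forall i, ((- C - r)%:E <= nu (l i))%E.
Proof.
elim: n v => [|n IHn] v freev; first by exists 0 => l r _ [].
pose w i := v (lift ord0 i).
have [|C CP] := IHn w.
  move=> l lw i.
  pose l' j := if unlift ord0 j is Some k then l k else 0.
  have := freev l' _ (lift ord0 i); rewrite /l' liftK; apply.
  rewrite big_ord_recl unlift_none scale0r add0r -[RHS]lw.
  by apply: eq_bigr => k _; rewrite liftK.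
have [r0 r0P] := rho_le_real (v ord0).
have [rw rwP] := rho_le_family w.
(* [v ord0] stays at a positive distance from the span of the other vectors:
   otherwise better and better approximations would form a Cauchy sequence. *)
have [D DP] : exists D : R, forall l : 'I_n -> F,
    (D%:E < rho (v ord0 + \sum_(i < n) l i *: w i))%E.
  apply: contrapT => noD.
  have /choice[m mP] : forall N : nat, exists l : 'I_n -> F,
      (rho (v ord0 + \sum_(i < n) l i *: w i) <= (- N%:R)%:E)%E.
    move=> N; apply: contrapT => /forallNP mN; apply: noD; exists (- N%:R) => l.
    by rewrite ltNge; apply/negP.
  have cauchy i N M : (N <= M)%N -> ((N%:R - C)%:E <= nu (m N i - m M i))%E.
    move=> NM; rewrite (_ : N%:R - C = - C - (- N%:R)); last by rewrite opprK addrC.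
    apply: (CP (fun i => m N i - m M i)).
    under eq_bigr do rewrite scalerBl.
    rewrite sumrB; set s := \sum_i _; set s' := \sum_i _.
    rewrite (_ : s - s' = (v ord0 + s) - (v ord0 + s')); last first.
      by rewrite opprD addrACA subrr add0r.
    apply: rhoB_le; first exact: mP.
    by apply: le_trans (mP M) _; rewrite lee_fin lerN2 ler_nat.
  have /choice[b bP] := fun i => nu_limit (cauchy i).
  set x := v ord0 + \sum_(i < n) b i *: w i.
  have xN (N : nat) : (rho x <= (Num.max 0 (rw + C) - N%:R)%:E)%E.
    have -> : x = (v ord0 + \sum_(i < n) m N i *: w i) - (\sum_(i < n) (m N i - b i) *: w i).
      under [X in _ - X]eq_bigr do rewrite scalerBl.
      by rewrite sumrB -addrA subKr.
    apply: rhoB_le.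
      by apply: le_trans (mP N) _; rewrite lee_fin lerDr le_max lexx.
    apply: rho_sum_le => i _.
    apply: (@le_trans _ _ (rw - (N%:R - C))%:E).
      by apply: ge_rho_scale; [exact: rwP|rewrite -nuN opprB; exact: bP].
    by rewrite lee_fin opprB addrA lerD2r le_max lexx orbT.
  have x0 : x = 0.
    apply: contrapT => /eqP/rho_finE rx; set M := Num.max 0 (rw + C) in xN.
    have := xN (Num.truncn (M - fine (rho x))).+1; rewrite rx lee_fin.
    by have := truncnS_gt (M - fine (rho x)); lra.
  pose l' j := if unlift ord0 j is Some k then b k else 1.
  have := freev l' _ ord0; rewrite /l' unlift_none => l0.
  suff : (1 : F) = 0 by apply/eqP; exact: oner_neq0.
  apply: l0; rewrite big_ord_recl unlift_none scale1r -[RHS]x0 /x; congr (_ + _).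
  by apply: eq_bigr => k _; rewrite liftK.
(* The distance [D] controls the coordinate along [v ord0], and after subtraction
   of this component the induction hypothesis controls the other coordinates. *)
exists (Num.max (- D) (C + Num.max 0 (r0 - D))) => l r.
rewrite big_ord_recl /=.
have tail_bound s : (rho (\sum_(i < n) l (lift ord0 i) *: w i) <= s%:E)%E ->
    forall i, ((- C - s)%:E <= nu (l (lift ord0 i)))%E.
  exact: (CP (fun i => l (lift ord0 i))).
have maxP1 : - D <= Num.max (- D) (C + Num.max 0 (r0 - D)) by rewrite le_max lexx.
have maxP2 : C + Num.max 0 (r0 - D) <= Num.max (- D) (C + Num.max 0 (r0 - D)).
  by rewrite le_max lexx orbT.
have maxP3 : 0 <= Num.max 0 (r0 - D) by rewrite le_max lexx.
have maxP4 : r0 - D <= Num.max 0 (r0 - D) by rewrite le_max lexx orbT.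
set C' := Num.max (- D) _ in maxP1 maxP2 *; set m := Num.max 0 _ in maxP2 maxP3 maxP4.
have [l00|l00] := eqVneq (l ord0) 0.
  rewrite l00 scale0r add0r => /tail_bound lP i.
  have [j ->|->] := unliftP ord0 i; last by rewrite l00 nu0 leey.
  by apply: le_trans (lP j); rewrite lee_fin; lra.
move=> xr; have [g [_ _ nug _]] := nu_min l00.
have gD : D - r < g.
  have := DP (fun i => (l ord0)^-1 * l (lift ord0 i)).
  under eq_bigr do rewrite -scalerA.
  rewrite -scaler_sumr => Dx; move: xr.
  rewrite -[X in _ + X]scale1r -[X in X *: \sum_i _](divff l00) -scalerA -scalerDr rhoZ.
  move: Dx; set y := _ + _; have [->|/rho_finE->] := eqVneq y 0; first by rewrite rho0.
  by rewrite nug -EFinB lte_fin lee_fin; lra.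
have {}tail_bound : forall i, ((- C - (r + m))%:E <= nu (l (lift ord0 i)))%E.
  apply: tail_bound; set s := \sum_i _.
  rewrite (_ : s = (l ord0 *: v ord0 + s) - l ord0 *: v ord0); last first.
    by rewrite addrAC subrr add0r.
  apply: rhoB_le; first by apply: le_trans xr _; rewrite lee_fin; lra.
  apply: (@le_trans _ _ (r0 - g)%:E).
    by apply: ge_rho_scale => //; rewrite nug.
  by rewrite lee_fin; lra.
move=> i; have [j ->|->] := unliftP ord0 i.
  by apply: le_trans (tail_bound j); rewrite lee_fin; lra.
by rewrite nug lee_fin; lra.
Qed.

(** The finite values of the norm lie in finitely many cosets of [Gamma]: vectors
    whose norms are pairwise incongruent are linearly independent. *)
Lemma rho_cosets : exists s : seq R, forall x : V, x != 0 ->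
  exists2 r, r \in s & fine (rho x) - r \in Gamma.
Proof.
apply: contrapT => nos.
pose inequivalent := fun x y : V => fine (rho x) - fine (rho y) \notin Gamma.
have chain n : exists s : seq V, [/\ size s = n, all (fun x => x != 0) s & pairwise inequivalent s].
  elim: n => [|n [s [<- s0 s_pw]]]; first by exists [::].
  have [x x0 xs] : exists2 x : V, x != 0 & all (inequivalent x) s.
    apply: contrapT => nox; apply: nos; exists [seq fine (rho y) | y <- s] => x x0.
    apply: contrapT => xs; apply: nox; exists x => //; apply/allP => y ys.
    apply/negP => xy; apply: xs; exists (fine (rho y)) => //.
    exact: map_f.
  by exists (x :: s); rewrite /= x0 s0 s_pw xs.
have [s [ss s0 s_pw]] := chain (\dim {:V}).+1.
suff : free s by rewrite /free ss => /eqP E; have := dimvS (subvf <<s>>); rewrite E ltnn.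
rewrite -(in_tupleE s); apply/freeP => k sk0.
set X := in_tuple s in sk0.
have X0 (i : 'I_(size s)) : X`_i != 0 by apply: (allP s0); exact: mem_nth.
have Xneq (i j : 'I_(size s)) : i != j -> fine (rho X`_i) - fine (rho X`_j) \notin Gamma.
  wlog ij : i j / (i < j)%N => [th|_].
    move=> ij; case: (ltngtP i j) => [?|?|/val_inj E]; first exact: th.
      by rewrite -opprB rpredN; apply: th => //; rewrite eq_sym.
    by rewrite E eqxx in ij.
  by apply: (pairwiseP 0 s_pw i j) => //; rewrite inE.
apply: contrapT => /existsNP[i0 /eqP ki0].
pose val i := fine (rho (k i *: X`_i)).
have valE i : k i != 0 -> val i = fine (rho X`_i) - fine (nu (k i)).
  by move=> ki; rewrite /val rhoZ (rho_finE (X0 i)) (nu_finE ki) -EFinB.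
(* A relation between the vectors has only one term of largest norm. *)
have [i ki imax] := @Order.TotalTheory.arg_maxP _ _ _ i0 (fun i => k i != 0) val ki0.
have {}imax j : k j != 0 -> val j <= val i by exact: imax.
have term i' : k i' != 0 -> k i' *: X`_i' != 0.
  by move=> ki'; rewrite scaler_eq0 negb_or ki' X0.
have : (rho (- (k i *: X`_i)) < (val i)%:E)%E.
  have -> : - (k i *: X`_i) = \sum_(j < size s | j != i) k j *: X`_j.
    by move: sk0; rewrite (bigD1 i)//= addrC => /eqP; rewrite addr_eq0 => /eqP.
  apply: rho_sum_lt => [|j ji]; first exact: ltNyr.
  have [->|kj] := eqVneq (k j) 0; first by rewrite scale0r rho0 ltNyr.
  rewrite rho_finE ?term// lte_fin -/(val j) lt_neqAle imax// andbT.
  apply: contra (Xneq j i ji) => /eqP vE.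
  have -> : fine (rho X`_j) - fine (rho X`_i) = fine (nu (k j)) - fine (nu (k i)).
    by move: vE; rewrite !valE//; lra.
  by rewrite rpredB ?nu_Gamma.
by rewrite rhoN rho_finE ?term// lte_fin ltxx.
Qed.
End NormEquivalence.

(** * Greedy families *)

Section Greedy.
Context (R : realType) (Gamma : zmodClosed R) (K : fieldType).
Local Notation L := (Lambda Gamma K).
Context (H : lmodType L) (fgH : finitely_generated H).
Implicit Types (U D : side H) (e : nat -> H) (x y : H) (k m : nat).

(** Rational span: some nonzero multiple of [x] is a combination of the first
    [k] terms of [e]. *)
Definition in_span e k x : Prop :=
  exists2 a : L, a != 0 & exists c : nat -> L, a *: x = \sum_(i < k) c i *: e i.

Lemma in_span_mono e k m x : (k <= m)%N -> in_span e k x -> in_span e m x.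
Proof.
move=> km [a a0 [c ac]]; exists a => //; exists (fun i => if (i < k)%N then c i else 0).
rewrite ac (big_ord_widen _ (fun i => c i *: e i) km) [RHS](bigID (fun i : 'I_m => (i < k)%N))/=.
rewrite [X in _ + X]big1 ?addr0 => [|i /negPf->]; last by rewrite scale0r.
by apply: eq_bigr => i ->.
Qed.

Lemma in_span_ext e e' k x : (forall i, (i < k)%N -> e i = e' i) ->
  in_span e k x -> in_span e' k x.
Proof.
move=> ee' [a a0 [c ac]]; exists a => //; exists c; rewrite ac.
by apply: eq_bigr => i _; rewrite ee'.
Qed.

Lemma torsion_in_span e k x : x \in torsion H -> in_span e k x.
Proof.
move=> /asboolP[a a0 ax]; exists a => //; exists (fun=> 0).
by rewrite ax big1// => i _; rewrite scale0r.
Qed.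

(** If [x] is in the span of the first [k] terms but has an expression that
    involves [e k], then [e k] is in this span too. *)
Lemma in_span_last e k x (a : L) (b : nat -> L) :
  a *: x = \sum_(i < k.+1) b i *: e i -> b k != 0 -> in_span e k x -> in_span e k (e k).
Proof.
move=> ax bk [a' a'0 [c a'x]]; exists (a' * b k); first exact: Lambda_mul_neq0.
exists (fun i => a * c i - a' * b i).
have : a' *: (a *: x) = a *: (a' *: x) by rewrite !scalerA mulrC.
rewrite ax a'x big_ord_recr /= scalerDr scalerA => /eqP; rewrite addrC eq_sym -subr_eq.
move=> /eqP <-; rewrite !scaler_sumr -sumrB; apply: eq_bigr => i _.
by rewrite !scalerA scalerBl.
Qed.

Lemma side_map_neq0 U x : x \notin torsion H -> side_map U x != 0.
Proof. by apply: contraNneq => /(side_map_eq0 U fgH). Qed.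

(** The cost [rho_up - rho_down] of a non-torsion element [x], which is invariant
    under multiplication by a monomial. *)
Definition cost U D x : R := fine (rho (side_map U x)) + fine (rho (side_map D x)).

Lemma costC U D x : cost U D x = cost D U x.
Proof. exact: addrC. Qed.

Lemma rho_finE_map U x : x \notin torsion H ->
  rho (side_map U x) = (fine (rho (side_map U x)))%:E.
Proof. by move=> xt; apply/rho_finE/side_map_neq0. Qed.

Lemma cost_lt U D x (r s : R) : x \notin torsion H ->
  (rho (side_map U x) <= r%:E)%E -> (rho (side_map D x) < s%:E)%E -> cost U D x < r + s.
Proof.
move=> xt; rewrite (rho_finE_map U xt) (rho_finE_map D xt) lee_fin lte_fin /cost; lra.
Qed.

(** One of the sides is an upward one, the other a downward one. *)
Definition opposite U D : Prop :=
  reversed (side_completion D) = ~~ reversed (side_completion U).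

Lemma oppositeC U D : opposite U D -> opposite D U.
Proof. by rewrite /opposite => ->; rewrite negbK. Qed.

(** Write [a *: x] as a combination of an independent family.  The two valuations
    of a nonzero coordinate are bounded below by the two norms of [x], and their sum
    is not positive. *)
Lemma cost_bounded U D : opposite U D ->
  exists C, forall x, x \notin torsion H -> C <= cost U D x.
Proof.
move=> UD; have [d [h [a [a0 indh spanh]]]] := fg_independent_span fgH.
have [CU CUP] := norm_bounds_coordinates (side_map_free (V := U) a0 indh spanh).
have [CD CDP] := norm_bounds_coordinates (side_map_free (V := D) a0 indh spanh).
have nua (V : side H) : exists g : R, nu (incl (side_completion V) a) = g%:E.
  have [|g [_ _ nug _]] := @nu_min _ _ _ (side_completion V) (incl _ a).
    by apply: contra_neq a0; exact: incl_eq0.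
  by exists g.
have [gU nuU] := nua U; have [gD nuD] := nua D.
exists (gU + gD - CU - CD) => x xt; have [c ac] := spanh x.
have [i ci] : exists i, c i != 0.
  apply: contrapT => /forallNP c0; move/negP: xt; apply; apply/asboolP; exists a => //.
  by rewrite ac big1// => i _; have /negP := c0 i; rewrite negbK => /eqP->; rewrite scale0r.
have coord (V : side H) (g C : R) : nu (incl (side_completion V) a) = g%:E ->
    (forall (l : 'I_d -> side_completion V) (r : R),
      (rho (\sum_(i < d) l i *: side_map V (h i)) <= r%:E)%E ->
      forall i, ((- C - r)%:E <= nu (l i))%E) ->
    ((- C - (fine (rho (side_map V x)) - g))%:E <= nu (incl (side_completion V) (c i)))%E.
  move=> nug CP; apply: (CP (fun i => incl _ (c i))); under eq_bigr do rewrite -side_mapZ.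
  by rewrite -linear_sum -ac side_mapZ rhoZ nug (rho_finE_map _ xt) EFinB.
have := nu_opposite_le0 UD ci.
have := coord U gU CU nuU CUP; have := coord D gD CD nuD CDP.
have ci0 (V : side H) : incl (side_completion V) (c i) != 0.
  by apply: contra_neq ci; exact: incl_eq0.
rewrite (nu_finE (ci0 U)) (nu_finE (ci0 D)) -EFinD !lee_fin /cost; lra.
Qed.

(** Each of the first [m] terms of [e] has minimal cost among the elements outside
    the span of the previous terms. *)
Definition greedy U D e m : Prop := forall k, (k < m)%N ->
  ~ in_span e k (e k) /\ forall y, ~ in_span e k y -> cost U D (e k) <= cost U D y.

Lemma greedyC U D e m : greedy U D e m -> greedy D U e m.
Proof.
by move=> gr k /gr[ek ekP]; split=> // y /ekP; rewrite costC [leRHS]costC.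
Qed.

Lemma not_in_span_torsion e k x : ~ in_span e k x -> x \notin torsion H.
Proof. by move=> xk; apply/negP => /torsion_in_span. Qed.

Lemma greedy_torsion U D e m k : greedy U D e m -> (k < m)%N -> e k \notin torsion H.
Proof. by move=> gr /gr[/not_in_span_torsion]. Qed.

Lemma greedy_cost_le U D e m i k : greedy U D e m -> (i <= k < m)%N ->
  cost U D (e i) <= cost U D (e k).
Proof.
move=> gr /andP[ik km]; have [_] := gr i (leq_ltn_trans ik km); apply.
by have [+ _] := gr k km; apply: contra_not; exact: in_span_mono.
Qed.

Lemma cost_min U D e k : discrete_subgroup Gamma -> opposite U D ->
  (exists x, ~ in_span e k x) ->
  exists2 x, ~ in_span e k x & forall y, ~ in_span e k y -> cost U D x <= cost U D y.
Proof.
move=> discG UD [x0 x0k]; have [C CP] := cost_bounded UD.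
have [sU sUP] := rho_cosets U; have [sD sDP] := rho_cosets D.
pose A := [set cost U D x | x in [set x | ~ in_span e k x]].
have covA : coset_covered Gamma [seq r + s | r <- sU, s <- sD] A.
  move=> _ [x /not_in_span_torsion xt <-].
  have [r rU rG] := sUP _ (side_map_neq0 U xt); have [s sD' sG] := sDP _ (side_map_neq0 D xt).
  exists (r + s); first by apply/allpairsP; exists (r, s).
  by rewrite /cost opprD addrACA rpredD.
have [||_ [x xk <-] xmin] := @coset_covered_min _ _ _ A C (cost U D x0) discG covA.
- by exists x0.
- by move=> _ [y /not_in_span_torsion yt <-]; exact: CP.
- by exists x => // y yk; apply: xmin; exists y.
Qed.

(** A greedy family can be continued until it spans. *)
Lemma greedy_or_total U D m : discrete_subgroup Gamma -> opposite U D ->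
  (exists e, greedy U D e m) \/
  exists e k, greedy U D e k /\ forall x, in_span e k x.
Proof.
move=> discG UD; elim: m => [|m [[e gr]|]]; [by left; exists (fun=> 0)| |by right].
have [total|/existsNP/(cost_min discG UD)[x xm xmin]] := pselect (forall x, in_span e m x).
  by right; exists e, m.
left; exists (fun i => if (i < m)%N then e i else x) => k.
have ext j y : (j <= m)%N ->
    in_span (fun i => if (i < m)%N then e i else x) j y -> in_span e j y.
  by move=> jm; apply: in_span_ext => i ij; rewrite (leq_trans ij jm).
rewrite ltnS leq_eqVlt => /orP[/eqP->|km].
  rewrite ltnn; split=> [/(ext _ _ (leqnn m))//|y ym]; apply: xmin.
  by apply: contra_not ym => /(in_span_ext _); apply => i ->.
rewrite km; have [ek ekP] := gr k km; split=> [/(ext _ _ (ltnW km))//|y yk].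
apply: ekP; apply: contra_not yk; apply: in_span_ext => i ik.
by rewrite (ltn_trans ik km).
Qed.

(** A greedy family is orthogonal: a combination with too small a norm would,
    after keeping only leading monomials, be a cheaper choice than its last
    term. *)
Lemma greedy_orthogonal U D e m (l : 'I_m -> side_completion U) (M : R) :
  opposite U D -> greedy U D e m ->
  (rho (\sum_(i < m) l i *: side_map U (e i)) < M%:E)%E ->
  forall i, (rho (l i *: side_map U (e i)) < M%:E)%E.
Proof.
move=> UD gr sumM.
pose v (i : 'I_m) := side_map U (e i).
have v0 i : v i != 0 by apply: side_map_neq0; exact: greedy_torsion gr _.
apply: contrapT => /existsNP[i0 /negP]; rewrite -leNgt => i0M.
have l0 i : (M%:E <= rho (l i *: v i))%E -> l i != 0.
  by apply: contraTneq => ->; rewrite scale0r rho0 -ltNge ltNyr.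
pose val i := fine (rho (l i *: v i)).
have valE i : l i != 0 -> rho (l i *: v i) = (val i)%:E.
  by move=> li; apply: rho_finE; rewrite scaler_eq0 negb_or li v0.
have [j lj jmax] := @Order.TotalTheory.arg_maxP _ _ _ i0 (fun i => l i != 0) val (l0 _ i0M).
have {}jmax i : l i != 0 -> val i <= val j by exact: jmax.
(* [N] is the largest norm of a term and [I] the set of the terms attaining it;
   [y] is the sum of their leading monomials. *)
set N := val j in jmax.
have MN : M <= N by apply: le_trans (jmax i0 (l0 _ i0M)); rewrite -lee_fin -valE ?l0.
pose I := [pred i | (l i != 0) && (val i == N)].
have IP i : i \in I -> l i != 0 /\ val i = N by rewrite inE => /andP[? /eqP].
have lead i : exists a : L, if i \in I then
    [/\ a != 0, (nu (l i) < nu (l i - incl (side_completion U) a))%E &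
      nu (incl (side_completion D) a) = (- nu (l i))%E] else a = 0.
  case: (boolP (i \in I)) => [/IP[li _]|_]; last by exists 0.
  by have [a a0 [alt anu]] := nu_lead_opposite UD li; exists a.
have [a aP] := choice lead.
have jI : j \in I by rewrite inE lj eqxx.
have [k kI kmax] := @arg_maxnP _ j (fun i => i \in I) (fun i => i : nat) jI.
have {}kmax i : i \in I -> (i <= k)%N by exact: kmax.
pose y := \sum_(i < m) a i *: e i.
have ak0 : a k != 0 by have := aP k; rewrite kI => -[].
have yk : ~ in_span e k y.
  pose b n := if insub n is Some i then a i else 0.
  have bE (i : 'I_m) : b i = a i by rewrite /b valK.
  have [ekk _] := gr k (ltn_ord k).
  apply: contra_not ekk; apply: (@in_span_last e k y 1 b); last by rewrite bE.
  rewrite scale1r /y (big_ord_widen _ (fun i => b i *: e i) (ltn_ord k)).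
  rewrite [LHS](bigID (fun i : 'I_m => (i < k.+1)%N))/= [X in _ + X]big1 ?addr0.
    by apply: eq_bigr => i _; rewrite bE.
  move=> i; rewrite ltnS -ltnNge => ki; have := aP i.
  case: ifPn => [/kmax|_ ->]; last by rewrite scale0r.
  by rewrite leqNgt ki.
have yt := not_in_span_torsion yk.
have [_ /(_ y yk)] := gr k (ltn_ord k); apply/negP; rewrite -ltNge.
have -> : cost U D (e k) = (cost U D (e k) - N) + N by rewrite subrK.
rewrite costC; apply: cost_lt => //.
  rewrite /y linear_sum; apply: rho_sum_le => i _ /=.
  rewrite side_mapZ rhoZ; have := aP i; case: ifPn => [iI [_ _ ->]|_ ->]; last first.
    by rewrite rmorph0 nu0 (rho_finE_map _ (greedy_torsion gr (ltn_ord i))) leNye.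
  have [li vi] := IP i iI.
  have := @greedy_cost_le U D e m i k gr; rewrite ltn_ord andbT => /(_ (kmax i iI)).
  move: vi; rewrite /val rhoZ /cost.
  have et := greedy_torsion gr (ltn_ord i).
  rewrite /v (rho_finE_map U et) (rho_finE_map D et) (nu_finE li) -!EFinN -!EFinD /= lee_fin; lra.
have -> : side_map U y = \sum_(i < m) l i *: v i -
    \sum_(i < m) (l i - incl (side_completion U) (a i)) *: v i.
  rewrite /y linear_sum -sumrB; apply: eq_bigr => i _ /=.
  by rewrite side_mapZ scalerBl subKr.
apply: rhoB_lt; first by apply: lt_le_trans sumM _; rewrite lee_fin.
apply: rho_sum_lt => [|i _]; first exact: ltNyr.
have := aP i; case: ifPn => [iI [_ alt _]|iI ->].
  have [li vi] := IP i iI; move: vi; rewrite /val !rhoZ.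
  move: alt; rewrite (rho_finE (v0 i)) (nu_finE li) -EFinB /= => alt vN.
  set r := fine (rho (v i)) in vN *; rewrite -vN.
  move: alt; case: (nu (l i - _)) => [s| |] //=; last by move=> _; exact: ltNyr.
  by rewrite -EFinB !lte_fin; lra.
rewrite rmorph0 subr0; have [->|li] := eqVneq (l i) 0; first by rewrite scale0r rho0 ltNyr.
rewrite valE// lte_fin lt_neqAle jmax// andbT.
by move: iI; rewrite inE li.
Qed.
End Greedy.

(** Orthogonality with respect to the normalized norm of a side. *)
Definition orthogonal (R : realType) (Gamma : zmodClosed R) (K : fieldType)
    (H : lmodType (Lambda Gamma K)) (V : side H) d (x : 'I_d -> V) : Prop :=
  forall l : 'I_d -> side_completion V,
    (rho (\sum_(i < d) l i *: x i)%R = \big[maxe/-oo]_(i < d) (rho (x i) - nu (l i)))%E.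

Section GreedyBasis.
Context (R : realType) (Gamma : zmodClosed R) (K : fieldType).
Local Notation L := (Lambda Gamma K).
Context (H : lmodType L) (fgH : finitely_generated H).
Context (U D : side H) (e : nat -> H) (m : nat).
Hypotheses (UD : opposite U D) (gr : greedy U D e m).

Lemma greedy_orthogonalE : orthogonal (fun i : 'I_m => side_map U (e i)).
Proof.
move=> l; apply/le_anti/andP; split.
  apply: rho_sum_le => i _; rewrite rhoZ.
  by apply: le_bigmax.
apply: bigmax_le => [|i _]; first exact: leNye.
rewrite -rhoZ leNgt; apply/negP.
have [->|/rho_finE li] := eqVneq (l i *: side_map U (e i)) 0; first by rewrite rho0 ltNge leNye.
rewrite li => /(greedy_orthogonal fgH UD gr)/(_ i).
by rewrite li ltxx.
Qed.

Lemma greedy_free (l : 'I_m -> side_completion U) :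
  \sum_(i < m) l i *: side_map U (e i) = 0 -> forall i, l i = 0.
Proof.
move=> l0 i; apply: contrapT => /eqP li.
have ei : side_map U (e i) != 0 by apply: side_map_neq0 => //; exact: greedy_torsion gr _.
have : l i *: side_map U (e i) != 0 by rewrite scaler_eq0 negb_or li.
move=> /rho_finE liE.
have := @greedy_orthogonal _ _ _ _ fgH U D e m l (fine (rho (l i *: side_map U (e i)))) UD gr.
by rewrite l0 rho0 ltNyr => /(_ isT i); rewrite -liE ltxx.
Qed.

Lemma greedy_free_seq : free [seq side_map U (e i) | i : 'I_m <- enum 'I_m].
Proof.
have -> : [seq side_map U (e i) | i : 'I_m <- enum 'I_m] =
  [tuple side_map U (e i) | i < m] :> seq _ by [].
apply/freeP => l l0; apply: greedy_free; rewrite -[RHS]l0.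
by apply: eq_bigr => i _; rewrite -tnth_nth tnth_mktuple.
Qed.

Lemma greedy_size : (m <= \dim {:U})%N.
Proof.
have /eqP := greedy_free_seq; rewrite size_map size_enum_ord => <-.
exact: dimvS (subvf _).
Qed.

Hypothesis total : forall x, in_span e m x.

Lemma total_coordinates (V : side H) (a : L) (c : 'I_m -> L) (x : H) :
  a != 0 -> a *: x = \sum_(i < m) c i *: e i ->
  side_map V x = \sum_(i < m) (incl _ (c i) / incl _ a) *: side_map V (e i).
Proof.
move=> a0 ax.
have ia0 : incl (side_completion V) a != 0 by apply: contra_neq a0; exact: incl_eq0.
apply: (scalerI ia0); rewrite -side_mapZ ax linear_sum scaler_sumr.
by apply: eq_bigr => i _ /=; rewrite side_mapZ scalerA mulrCA divff// mulr1.
Qed.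

Lemma greedy_basis :
  basis_of fullv [seq side_map U (e i) | i : 'I_m <- enum 'I_m].
Proof.
rewrite /basis_of greedy_free_seq andbT eqEsubv subvf /=.
apply/subvP => v _; have [s ->] := phi_spans v.
apply: rpred_sum => p _; apply: rpredZ.
have [a a0 [c ax]] := total p.2.
rewrite (@total_coordinates U a (fun i => c i) _ a0 ax).
apply: rpred_sum => i _; apply/rpredZ/memv_span/mapP.
by exists i => //; rewrite mem_enum.
Qed.

(** The coordinates of [x] are cut, in both completions, at the exponent given by
    the norm of the corresponding basis element: the error is then too cheap to be
    anything but torsion. *)
Lemma greedy_generates x :
  exists c : 'I_m -> L, x - \sum_(i < m) c i *: e i \in torsion H.
Proof.
have [a a0 [c ax]] := total x.
pose G (i : nat) : R := fine (rho (side_map U (e i))).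
pose lU i : side_completion U := incl _ (c i) / incl _ a.
pose lD i : side_completion D := incl _ (c i) / incl _ a.
have /choice[cU cUP] i := nu_truncate_ge UD (lU i) (G i).
have /choice[cD cDP] i := nu_truncate_gt (oppositeC UD) (lD i) (- G i).
exists (fun i => cU i + cD i); apply: contrapT => /negP.
set x' := x - _ => x't.
(* The coordinates of the error [x'] are the [b i / a]. *)
pose b i := c i - a * (cU i + cD i).
have ax' : a *: x' = \sum_(i < m) b i *: e i.
  rewrite scalerBr ax scaler_sumr -sumrB; apply: eq_bigr => i _.
  by rewrite scalerA scalerBl.
have bE (V : side H) i : incl (side_completion V) (b i) / incl _ a =
    incl _ (c i) / incl _ a - incl _ (cU i) - incl _ (cD i).
  have ia0 : incl (side_completion V) a != 0 by apply: contra_neq a0; exact: incl_eq0.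
  by rewrite rmorphB rmorphM rmorphD /= mulrBl mulrAC divff// mul1r opprD addrA.
have [i0 bi0] : exists i : 'I_m, b i != 0.
  apply: contrapT => /forallNP b0; move/negP: x't; apply; apply/asboolP; exists a => //.
  by rewrite ax' big1// => i _; have /negP := b0 i; rewrite negbK => /eqP->; rewrite scale0r.
have [k bk kmax] := @arg_maxnP _ i0 (fun i : 'I_m => b i != 0) (fun i => i : nat) bi0.
have {}kmax (i : 'I_m) : b i != 0 -> (i <= k)%N by exact: kmax.
have x'k : ~ in_span e k x'.
  have [ekk _] := gr (ltn_ord k); apply: contra_not ekk.
  apply: (@in_span_last _ _ _ _ e k x' a b) => //.
  rewrite ax' (big_ord_widen _ (fun i => b i *: e i) (ltn_ord k)).
  rewrite [LHS](bigID (fun i : 'I_m => (i < k.+1)%N))/= [X in _ + X]big1 ?addr0//.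
  move=> i; rewrite ltnS => ki; have [->|/kmax ik] := eqVneq (b i) 0; first by rewrite scale0r.
  by rewrite ik in ki.
have [_ /(_ x' x'k)] := gr (ltn_ord k); apply/negP; rewrite -ltNge -[ltRHS]add0r.
have et (i : 'I_m) : e i \notin torsion H by exact: greedy_torsion gr _.
apply: cost_lt => //.
  rewrite (total_coordinates U a0 ax'); apply: rho_sum_le => i _.
  rewrite bE -(subrr (G i)); apply: ge_rho_scale; first by rewrite -rho_finE_map.
  have [lge _] := cUP i; have [_] := cDP i; rewrite opprK => cge.
  by apply: nuD_ge => //; rewrite nuN.
rewrite (total_coordinates D a0 ax'); apply: rho_sum_lt => [|i _]; first exact: ltNyr.
have [->|bi] := eqVneq (b i) 0; first by rewrite rmorph0 mul0r scale0r rho0 ltNyr.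
have : ((- G i)%:E < nu (incl (side_completion D) (b i) / incl _ a))%E.
  rewrite bE addrAC; apply: nuD_gt; last by rewrite nuN; have [] := cUP i.
  by have [] := cDP i.
have := @greedy_cost_le _ _ _ _ U D e m i k gr; rewrite ltn_ord andbT => /(_ (kmax i bi)).
rewrite rhoZ (rho_finE_map fgH D (et i)) /cost -/(G i).
case: (nu _) => [s| |] //=; last by move=> _ _; exact: ltNyr.
by rewrite -EFinB !lte_fin; lra.
Qed.
End GreedyBasis.

(** * Existence of doubly-orthogonal bases *)

Section DoublyOrthogonal.
Context (R : realType) (Gamma : zmodClosed R) (K : fieldType).
Local Notation L := (Lambda Gamma K).
Context (H : lmodType L) (P : matched_pair H).

Lemma opposite_sides : opposite (up_side P) (down_side P).
Proof. by []. Qed.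

Lemma bigmax_oppe d (f : 'I_d -> \bar R) :
  (\big[maxe/-oo]_(i < d) (- f i) = - \big[mine/+oo]_(i < d) f i)%E.
Proof.
by apply/esym; apply: (big_morph _ (fun x y => oppe_min x y)).
Qed.

Lemma proj_torsion_sum d (e : 'I_d -> H) (b : 'I_d -> L) :
  \sum_(i < d) b i *: proj_torsion (e i) = proj_torsion (\sum_(i < d) b i *: e i).
Proof.
have p0 : proj_torsion (0 : H) = 0.
  apply: (addrI (proj_torsion (0 : H))).
  by rewrite -proj_torsionD !addr0.
elim/big_rec2: _ => [|i y1 y2 _ ->]; first by rewrite p0.
by rewrite proj_torsionD; congr (_ + _); exact: proj_torsionZ.
Qed.

(** On the downward side, the normalized norm turns minima into maxima. *)
Lemma orthogonal_downP d (e : 'I_d -> H) :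
  orthogonal_down (fun i => phi_down P (e i)) <->
  orthogonal (fun i => side_map (down_side P) (e i)).
Proof.
have negE (l : 'I_d -> Lambda_down Gamma K) :
    (\big[maxe/-oo]_(i < d) (rho (side_map (down_side P) (e i)) -
       @nu _ _ _ (down_completion Gamma K) (l i)) =
    - \big[mine/+oo]_(i < d) (rho_down (phi_down P (e i)) - nu_down (l i)))%E.
  by rewrite -bigmax_oppe; apply: eq_bigr => i _; rewrite -rhoZ /= rho_downZ.
split=> orth l; last by apply: oppe_inj; rewrite -negE; exact: orth.
by rewrite negE -(orth l).
Qed.

Lemma exists_doubly_orthogonal_basis : discrete_subgroup Gamma ->
  exists d (e : 'I_d -> H), doubly_orthogonal_basis P e.
Proof.
move=> discG; have fgH := pair_fg P; have UD := opposite_sides; have DU := oppositeC UD.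
have [[e gr]|[e [m [gr total]]]] :=
    greedy_or_total fgH (\dim {:up_side P}).+1 discG UD.
  by have := greedy_size fgH UD gr; rewrite ltnn.
have gr' := greedyC gr.
exists m, (fun i => e i); split.
- move=> x; have [c xc] := greedy_generates fgH UD gr total (repr x).
  have cE : x = \sum_(i < m) c i *: proj_torsion (e i).
    by rewrite proj_torsion_sum -[LHS]proj_torsion_repr; apply/proj_torsionP.
  exists [ffun i => c i]; split.
    by rewrite [LHS]cE; apply: eq_bigr => i _; rewrite ffunE.
  move=> c' c'E; apply/ffunP => i; rewrite ffunE.
  have : \sum_(i < m) (c i - c' i) *: e i \in torsion H.
    under eq_bigr do rewrite scalerBl.
    by rewrite sumrB; apply/proj_torsionP; rewrite -!proj_torsion_sum -c'E -cE.
  move=> /(side_map_eq0 (up_side P) fgH); rewrite side_map_sum.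
  move=> /(greedy_free fgH UD gr)/(_ i)/incl_eq0/eqP.
  by rewrite subr_eq0 => /eqP.
- split; first exact: (greedy_basis fgH UD gr total).
  exact: (greedy_orthogonalE fgH UD gr).
- split; first exact: (greedy_basis fgH DU gr' total).
  by apply/orthogonal_downP; exact: (greedy_orthogonalE fgH DU gr').
Qed.
End DoublyOrthogonal.

(** * Matching two bases *)

Section BaseChange.
Context (R : realType) (Gamma : zmodClosed R) (K : fieldType).
Local Notation L := (Lambda Gamma K).

Lemma module_basis_coordinates (A : nzRingType) (M : lmodType A) d (e : 'I_d -> M) :
  module_basis e -> forall c c' : 'I_d -> A,
  \sum_(i < d) c i *: e i = \sum_(i < d) c' i *: e i -> c =1 c'.
Proof.
move=> be c c' cc' i; have [b [_ bP]] := be (\sum_(i < d) c i *: e i).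
have bE (q : 'I_d -> A) : \sum_(i < d) c i *: e i = \sum_(i < d) q i *: e i -> b = [ffun i => q i].
  by move=> cq; apply: bP; rewrite cq; apply: eq_bigr => k _; rewrite ffunE.
by have := bE c' cc'; rewrite (bE c erefl) => /ffunP/(_ i); rewrite !ffunE.
Qed.

(** Two bases are related by mutually inverse matrices. *)
Lemma base_change (A : comNzRingType) (M : lmodType A) d d' (e : 'I_d -> M) (f : 'I_d' -> M) :
  module_basis e -> module_basis f ->
  exists (B : 'M[A]_(d, d')) (C : 'M[A]_(d', d)),
    [/\ forall i, e i = \sum_(j < d') B i j *: f j,
        forall j, f j = \sum_(i < d) C j i *: e i, B *m C = 1%:M & C *m B = 1%:M].
Proof.
move=> be bf.
have coords n n' (x : 'I_n -> M) (y : 'I_n' -> M) : module_basis y ->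
    exists B : 'M[A]_(n, n'), forall i, x i = \sum_(j < n') B i j *: y j.
  move=> by_; have /choice[c cP] i : exists c : {ffun 'I_n' -> A},
      x i = \sum_(j < n') c j *: y j.
    by have [c [cP _]] := by_ (x i); exists c.
  by exists (\matrix_(i, j) c i j) => i; rewrite cP; apply: eq_bigr => j _; rewrite mxE.
have inverse n n' (x : 'I_n -> M) (y : 'I_n' -> M) (B : 'M[A]_(n, n')) (C : 'M[A]_(n', n)) :
    module_basis x -> (forall i, x i = \sum_(j < n') B i j *: y j) ->
    (forall j, y j = \sum_(i < n) C j i *: x i) -> B *m C = 1%:M.
  move=> bx xB yC; apply/matrixP => i k.
  apply: (module_basis_coordinates bx (c := (B *m C) i) (c' := 1%:M i)).
  transitivity (x i).
    rewrite [RHS]xB; under [RHS]eq_bigr do rewrite yC scaler_sumr.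
    rewrite exchange_big; apply: eq_bigr => l _ /=.
    by rewrite mxE scaler_suml; apply: eq_bigr => j _; rewrite scalerA.
  rewrite (bigD1 i)//= mxE eqxx scale1r big1 ?addr0// => j.
  by rewrite mxE eq_sym => /negPf->; rewrite scale0r.
have [B BP] := coords d d' e f bf; have [C CP] := coords d' d f e be.
by exists B, C; split=> //; [exact: inverse BP CP|exact: inverse CP BP].
Qed.

Section Matching.
Context (d d' : nat) (B : 'M[L]_(d, d')) (C : 'M[L]_(d', d)).
Context (a a' : 'I_d -> R) (b b' : 'I_d' -> R) (t : R).
Hypotheses (BC : B *m C = 1%:M) (CB : C *m B = 1%:M).
Hypothesis B_supp : forall i j g, B i j g != 0 ->
  b j - g <= a i + t /\ a' i - t <= b' j - g.
Hypothesis C_supp : forall j i g, C j i g != 0 ->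
  a i - g <= b j + t /\ b' j - t <= a' i - g.

(** Some translate of the [j]-th pair is [t]-close to the [i]-th pair. *)
Definition matchable (i : 'I_d) (j : 'I_d') : bool :=
  `[< exists2 g, g \in Gamma & `|g + b j - a i| <= t /\ `|g + b' j - a' i| <= t >].

(** The step that makes [B_SN *m C_NS] unitriangular, for [N] the set of the
    indices matchable with an element of [S]. *)
Lemma unmatchable_order i i' j :
  ~~ matchable i j -> ~~ matchable i' j -> B i j != 0 -> C j i' != 0 ->
  a i' - a' i' < a i - a' i.
Proof.
move=> /asboolPn/forall2NP ij /asboolPn/forall2NP i'j /fs_neq0[g Bg] /fs_neq0[h Ch].
have [B1 B2] := B_supp Bg; have [C1 C2] := C_supp Ch.
have [//|{}ij] := ij (- g); first by rewrite rpredN (supp_Gamma Bg).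
have [//|{}i'j] := i'j h; first by rewrite (supp_Gamma Ch).
have {ij}[ij|ij] : b j - g < a i - t \/ a' i + t < b' j - g.
  apply: contrapT => /not_orP[/negP + /negP]; rewrite -!leNgt => ? ?.
  by apply: ij; rewrite !ler_norml; split; apply/andP; split; lra.
all: have {i'j}[i'j|i'j] : a i' + t < h + b j \/ h + b' j < a' i' - t.
all: try lra.
all: apply: contrapT => /not_orP[/negP + /negP]; rewrite -!leNgt => ? ?.
all: by apply: i'j; rewrite !ler_norml; split; apply/andP; split; lra.
Qed.

Let incl_up : {rmorphism L -> Lambda_up Gamma K} := @to_up R Gamma K.

(** Hall's condition.  Otherwise some nonzero combination [x] of the rows of [B]
    with indices in [S] vanishes on the columns in [N]; since [B *m C = 1], the
    coordinate of [x] at the largest [a i - a' i] is a sum of terms through the other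
    columns, which all vanish by [unmatchable_order]. *)
Lemma matchable_hall (S : {set 'I_d}) : (#|S| <= #|neighbours matchable S|)%N.
Proof.
rewrite leqNgt; apply/negP => ltNS; set N := neighbours matchable S in ltNS.
pose A : 'M[Lambda_up Gamma K]_(#|S|, #|N|) :=
  \matrix_(k, l) incl_up (B (enum_val k) (enum_val l)).
have /rowV0Pn[x /sub_kermxP xA x0] : kermx A != 0.
  rewrite kermx_eq0 /row_free; apply/negP => /eqP rA.
  by have := rank_leq_col A; rewrite rA leqNgt ltNS.
have [k0 xk0] := rV0Pn _ x0.
pose s k := a (@enum_val _ (mem S) k) - a' (@enum_val _ (mem S) k).
have [k xk kmax] := @Order.TotalTheory.arg_maxP _ _ _ k0 (fun k => x 0 k != 0) s xk0.
have {}kmax l : x 0 l != 0 -> s l <= s k by exact: kmax.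
move/negP: xk; apply; apply/eqP.
set i := enum_val k.
have -> : x 0 k = \sum_(l < #|S|) x 0 l * incl_up ((B *m C) (enum_val l) i).
  rewrite BC (bigD1 k)//= mxE eqxx rmorph1 mulr1 big1 ?addr0// => l lk.
  by rewrite mxE (inj_eq enum_val_inj) (negPf lk) rmorph0 mulr0.
have -> : \sum_(l < #|S|) x 0 l * incl_up ((B *m C) (enum_val l) i) =
    \sum_(j < d') \sum_(l < #|S|) x 0 l * incl_up (B (enum_val l) j) * incl_up (C j i).
  rewrite exchange_big; apply: eq_bigr => l _ /=.
  rewrite mxE rmorph_sum mulr_sumr; apply: eq_bigr => j _.
  by rewrite rmorphM mulrA.
apply: big1 => j _; have [jN|jN] := boolP (j \in N).
  rewrite -mulr_suml; have /rowP/(_ (enum_rank_in jN j)) := xA.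
  rewrite !mxE; under eq_bigr do rewrite mxE enum_rankK_in//.
  by move=> ->; rewrite mul0r.
have unm (l : 'I_#|S|) : ~~ matchable (enum_val l) j.
  apply: contra jN => lj; rewrite inE; apply/existsP; exists (enum_val l).
  by rewrite enum_valP.
apply: big1 => l _; have [->|xl] := eqVneq (x 0 l) 0; first by rewrite !mul0r.
have [->|Bl] := eqVneq (B (enum_val l) j) 0; first by rewrite rmorph0 mulr0 mul0r.
have [->|Ck] := eqVneq (C j i) 0; first by rewrite rmorph0 mulr0.
by have := unmatchable_order (unm l) (unm k) Bl Ck; rewrite ltNge -/(s l) -/(s k) kmax.
Qed.

Lemma matching_exists : exists2 sigma : 'I_d -> 'I_d', bijective sigma &
  forall i, exists2 g, g \in Gamma &
    `|g + b (sigma i) - a i| <= t /\ `|g + b' (sigma i) - a' i| <= t.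
Proof.
have le n n' (X : 'M[L]_(n, n')) (Y : 'M[L]_(n', n)) : X *m Y = 1%:M -> (n <= n')%N.
  move=> /(congr1 (map_mx incl_up)); rewrite map_mxM map_mx1.
  exact: mulmx1_min.
have [sigma sigma_inj sigmaP] := hall matchable_hall.
exists sigma => [|i]; last exact/asboolP/sigmaP.
by apply: inj_card_bij => //; rewrite !card_ord (le _ _ _ _ CB).
Qed.
End Matching.
End BaseChange.

(** * Matching the basis spectra *)

Section SpectrumMatching.
Context (R : realType) (Gamma : zmodClosed R) (K : fieldType).
Local Notation L := (Lambda Gamma K).
Context (H : lmodType L).

(** No term of the expansion of [x] in an orthogonal family has larger norm than
    [x]. *)
Lemma orthogonal_entry (V : side H) d (f : 'I_d -> H) (c : 'I_d -> L) (x : H) j g :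
  finitely_generated H ->
  orthogonal (fun i => side_map V (f i)) ->
  proj_torsion x = \sum_(i < d) c i *: proj_torsion (f i) ->
  x \notin torsion H -> f j \notin torsion H -> c j g != 0 ->
  fine (rho (side_map V (f j))) - signed (reversed (side_completion V)) g <=
    fine (rho (side_map V x)).
Proof.
move=> fgH orth xE xt fjt cjg.
have phixE : side_map V x = \sum_(i < d) incl _ (c i) *: side_map V (f i).
  apply/eqP; rewrite -subr_eq0 -side_map_sum -linearB; apply/eqP/(side_map_eq0 V fgH).
  by apply/proj_torsionP; rewrite xE proj_torsion_sum.
have cj0 : incl (side_completion V) (c j) != 0.
  by apply: contraNneq cjg => /incl_eq0 ->; rewrite fs0.
have le_rho : (rho (side_map V (f j)) - nu (incl (side_completion V) (c j)) <=
    rho (side_map V x))%E.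
  rewrite phixE orth.
  exact: (le_bigmax _ (fun i => rho (side_map V (f i)) - nu (incl _ (c i)))%E).
have nu_ge : ((fine (nu (incl (side_completion V) (c j))))%:E <=
    nu (incl (side_completion V) (c j)))%E by rewrite -nu_finE.
have nu_le : fine (nu (incl (side_completion V) (c j))) <=
    signed (reversed (side_completion V)) g.
  by move/nu_incl_geP: nu_ge; exact.
move: le_rho; rewrite (rho_finE_map fgH V fjt) (rho_finE_map fgH V xt) (nu_finE cj0).
by rewrite -EFinB lee_fin; lra.
Qed.

Lemma basis_not_torsion (P : matched_pair H) d (e : 'I_d -> H) i :
  doubly_orthogonal_basis P e -> e i \notin torsion H.
Proof.
move=> [_ [be _] _]; apply/negP => /(side_map_eq0 (up_side P) (pair_fg P)) /= ei0.
have := free_not0 (basis_free be) (_ : phi_up P (e i) \in _).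
by move=> /(_ (map_f _ (mem_enum _ i))); rewrite ei0 eqxx.
Qed.

Lemma spectra_matching (P Q : matched_pair H) (t : R) d d' (e : 'I_d -> H) (f : 'I_d' -> H) :
  t_morphism t P Q -> doubly_orthogonal_basis P e -> doubly_orthogonal_basis Q f ->
  exists2 sigma : 'I_d -> 'I_d', bijective sigma &
    forall i, exists2 g, g \in Gamma &
      `|g + fine (rho_up (phi_up Q (f (sigma i)))) - fine (rho_up (phi_up P (e i)))| <= t /\
      `|g + fine (rho_down (phi_down Q (f (sigma i)))) - fine (rho_down (phi_down P (e i)))| <= t.
Proof.
move=> morph eP fQ.
have [be [_ eU] [_ /orthogonal_downP eD]] := eP.
have [bf [_ fU] [_ /orthogonal_downP fD]] := fQ.
have fgH := pair_fg P.
have et i := basis_not_torsion i eP; have ft j := basis_not_torsion j fQ.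
have [B [C [eE fE BC CB]]] := base_change be bf.
have close_up x : x \notin torsion H ->
    `|fine (rho_up (phi_up P x)) - fine (rho_up (phi_up Q x))| <= t.
  move=> xt; have := alpha_up_close morph xt.
  have /= -> := rho_finE_map fgH (up_side P) xt; have /= -> := rho_finE_map fgH (up_side Q) xt.
  by rewrite -EFinB abse_EFin lee_fin.
have close_down x : x \notin torsion H ->
    `|fine (rho_down (phi_down P x)) - fine (rho_down (phi_down Q x))| <= t.
  move=> xt; have := alpha_down_close morph xt.
  have /eqP := rho_finE_map fgH (down_side P) xt.
  rewrite /= eqe_oppLR fineN -EFinN opprK => /eqP ->.
  have /eqP := rho_finE_map fgH (down_side Q) xt.
  rewrite /= eqe_oppLR fineN -EFinN opprK => /eqP ->.
  by rewrite -EFinB abse_EFin lee_fin.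
apply: (@matching_exists _ _ _ _ _ B C (fun i => fine (rho_up (phi_up P (e i))))
  (fun i => fine (rho_down (phi_down P (e i)))) (fun j => fine (rho_up (phi_up Q (f j))))
  (fun j => fine (rho_down (phi_down Q (f j)))) t BC CB) => [i j g Bg|j i g Cg].
  have := orthogonal_entry (V := up_side Q) fgH fU (eE i) (et i) (ft j) Bg.
  have := orthogonal_entry (V := down_side Q) fgH fD (eE i) (et i) (ft j) Bg.
  have := close_up _ (et i); have := close_down _ (et i).
  by rewrite /= !fineN !ler_norml => /andP[? ?] /andP[? ?] ? ?; split; lra.
have := orthogonal_entry (V := up_side P) fgH eU (fE j) (ft j) (et i) Cg.
have := orthogonal_entry (V := down_side P) fgH eD (fE j) (ft j) (et i) Cg.
have := close_up _ (ft j); have := close_down _ (ft j).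
by rewrite /= !fineN !ler_norml => /andP[? ?] /andP[? ?] ? ?; split; lra.
Qed.

(** The positions of the multiset of values of a finite family correspond
    bijectively to the indices of the family. *)
Lemma seq_mset_indices (T : choiceType) d (f : 'I_d -> T) :
  exists2 p : 'I_(size (seq_mset [seq f i | i <- enum 'I_d])) -> 'I_d, bijective p &
    forall i, tnth (in_tuple (seq_mset [seq f i | i <- enum 'I_d])) i = f (p i).
Proof.
set S := seq_mset _.
have /tuple_permP[s Ss] : perm_eq S [tuple f i | i < d] by exact: perm_eq_seq_mset.
have sizeS : size S = d by rewrite Ss size_tuple.
exists (fun i => s (cast_ord sizeS i)) => [|i].
  exists (fun i => cast_ord (esym sizeS) (s^-1%g i)) => i.
    by rewrite permK cast_ordK.
  by rewrite cast_ordKV permKV.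
have nthS (k : 'I_d) : nth (f (s k)) S k = f (s k).
  by rewrite Ss -tnth_nth !tnth_mktuple.
by rewrite (tnth_nth (f (s (cast_ord sizeS i)))); exact: (nthS (cast_ord sizeS i)).
Qed.
End SpectrumMatching.

Theorem theorem5p12 (R : realType) (Gamma : zmodClosed R) (K : fieldType)
    (H : lmodType (Lambda Gamma K)) (P Q : matched_pair H) (t : R) :
  finitely_generated_subgroup Gamma ->
  discrete_subgroup Gamma ->
  0 <= t ->
  t_morphism t P Q ->
  strong_matching t (basis_spectrum P) (basis_spectrum Q).
Proof.
move=> _ discG _ morph.
have spectrumE (P' : matched_pair H) : exists d (e : 'I_d -> H),
    doubly_orthogonal_basis P' e /\ basis_spectrum P' = spectrum_of P' e.
  have [d [e eP]] := exists_doubly_orthogonal_basis P' discG.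
  rewrite /basis_spectrum; set A := [set _ | _].
  by have : A (xget mset0 A); [apply: (xgetPex mset0); exists (spectrum_of P' e), d, e|].
have [d [e [eP ->]]] := spectrumE P; have [d' [f [fQ ->]]] := spectrumE Q.
have [sigma sigma_bij sigmaP] := spectra_matching morph eP fQ.
rewrite /spectrum_of.
set F := fun i : 'I_d => _; set G := fun i : 'I_d' => _.
have [p p_bij pE] := seq_mset_indices F; have [q q_bij qE] := seq_mset_indices G.
have [q' q'K qK] := q_bij.
exists (q' \o sigma \o p).
  by apply: bij_comp p_bij; apply: bij_comp sigma_bij; exists q.
have piP (x y : R) : \pi_(Quotient.quot Gamma)%qT x = \pi_(Quotient.quot Gamma)%qT y ->
    x - y \in Gamma.
  by move=> /eqP; rewrite -Quotient.idealrBE.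
move=> i a l b m; rewrite pE qE /= qK /F /G => -[/piP aG la] [/piP bG mb].
have [g gG [gup gdown]] := sigmaP (p i).
move: aG la bG mb gup gdown.
set a0 := fine (rho_up (phi_up P _)); set a0' := fine (rho_down (phi_down P _)).
set b0 := fine (rho_up (phi_up Q _)); set b0' := fine (rho_down (phi_down Q _)).
(* The representatives [a] and [b] of the classes differ from [a0] and [b0] by
   elements of [Gamma], which are absorbed in the translation. *)
move=> aG la bG mb gup gdown; exists (g - (a0 - a) + (b0 - b)).
  by rewrite rpredD// rpredB.
split.
  by rewrite (_ : _ - a = g + b0 - a0)//; ring.
by rewrite -la -mb (_ : _ - _ = g + b0' - a0')//; ring.
Qed.
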